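(* Let $X_1$ and $X_2$ be independent and identically distributed real random variables with mean $\mu$, variance $\sigma^2 > 0$ and densities (with respect to Lebesgue measure). Let $\Phi_{\mu,\sigma^2}$ be the distribution function of $N(\mu,\sigma^2)$ and $F_{(X_1+X_2)/\sqrt{2}}$ the distribution function of $(X_1+X_2)/\sqrt{2}$, and define $g(u) = \Phi_{\mu,\sigma^2}^{-1} \circ F_{(X_1 + X_2)/\sqrt{2}}(u)$. Let $c>0$. If the derivative satisfies $g'(u) \geq c$ for all $u$ (in the domain $\{u : 0 < F_{(X_1+X_2)/\sqrt{2}}(u) < 1\}$ of $g$), then $$D\left( \frac{X_1 + X_2}{\sqrt{2}} \right) \leq \left( 1 - \frac{c}{2} \right) D(X_1) + \frac{c\, D(X_1)^2}{8 \sigma^2} \leq \left( 1 - \frac{c}{4} \right) D(X_1).$$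
   Context: For distribution functions $F_X, F_Y$ on $\mathbb{R}$, $d_2(X,Y) = d_2(F_X,F_Y) = \left( \inf_{(X,Y)} \mathbb{E}|X-Y|^2 \right)^{1/2}$, where the infimum is taken over pairs $(X,Y)$ of random variables (on a common probability space) whose marginal distribution functions are $F_X$ and $F_Y$ respectively. For a random variable $X$ with finite mean $m$ and finite variance $s^2$, $D(X) = d_2(X, Z_{m,s^2})^2$, where $Z_{m,s^2}$ is a $N(m,s^2)$ random variable; that is, the comparison normal variable has the same mean and variance as $X$ itself. *)

(* Defs.v *)
From HB Require Import structures.
From mathcomp Require Import all_boot all_order all_algebra.
From mathcomp Require Import all_classical all_reals all_analysis measurable_realfun.

Set Implicit Arguments.
Unset Strict Implicit.
Unset Printing Implicit Defensive.
Import Order.TTheory GRing.Theory Num.Theory.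
Import numFieldNormedType.Exports.

Local Open Scope classical_set_scope.
Local Open Scope ring_scope.

Section random_variables.
Context (R : realType) (d : measure_display) (T : measurableType d)
  (P : probability T R).

Definition independent_RV (X Y : {RV P >-> R}) :=
  forall A B : set R, measurable A -> measurable B ->
    P (X @^-1` A `&` Y @^-1` B) = (P (X @^-1` A) * P (Y @^-1` B))%E.

Definition identically_distributed (X Y : {RV P >-> R}) :=
  forall A : set R, measurable A ->
    distribution P X A = distribution P Y A.

Definition has_density (X : {RV P >-> R}) :=
  exists f : R -> R,
    [/\ measurable_fun setT f, forall x, 0 <= f x &
        forall A : set R, measurable A ->
          distribution P X A = (\int[lebesgue_measure]_(x in A) (f x)%:E)%E].

(* (X + Y) / sqrt 2; note that [a \o* f] is [fun x => f x * a]. *)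
Definition normalized_sum (X Y : {RV P >-> R}) : {RV P >-> R} :=
  (Num.sqrt 2)^-1 \o* (X \+ Y).

End random_variables.

(* The distribution function of N(m, v), where v is the variance. The library's
   [normal_prob m s] takes the standard deviation s, and is not a Dirac mass for
   s = 0, hence the case distinction. *)
Definition normal_cdf (R : realType) (m v : R) (x : R) : \bar R :=
  if v == 0 then \d_m `]-oo, x] else normal_prob m (Num.sqrt v) `]-oo, x].

(* The inverse of the distribution function of N(m, v); for v > 0 the default
   value 0 is only taken outside of ]0, 1[. *)
Definition normal_cdf_inv (R : realType) (m v : R) : \bar R -> R :=
  'pinv_(fun=> 0) setT (normal_cdf m v).

(* The infimum runs over all couplings of F and G, on arbitrary probability
   spaces; it may be +oo. *)
Definition d2 (R : realType) (F G : R -> \bar R) : \bar R :=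
  sqrte (ereal_inf [set c : \bar R |
    exists (d : measure_display) (T : measurableType d) (P : probability T R)
           (X Y : {RV P >-> R}),
      [/\ cdf X = F, cdf Y = G & c = 'E_P[fun t => (`|X t - Y t| ^+ 2)%R]%E]]).

(* D(X): the squared d2-distance from X to the normal law with the mean and
   variance of X; only meaningful for X with a finite second moment, because of
   [fine]. *)
Definition normal_sqdist (R : realType) (d : measure_display)
    (T : measurableType d) (P : probability T R) (X : {RV P >-> R}) : \bar R :=
  (d2 (cdf X) (normal_cdf (fine 'E_P[X]) (fine 'V_P[X])) ^+ 2)%E.

(* Main.v *)
Require Import Defs.
From HB Require Import structures.
From mathcomp Require Import all_boot all_order all_algebra.
From mathcomp Require Import all_classical all_reals all_analysis measurable_realfun.
From mathcomp Require Import ring lra.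

(* Let (X, Y) be any coupling of X1 with N(mu, sigma^2), and (x, y) its
   standardization. Two independent copies give s = (x1 + x2) / sqrt 2, which has
   the law of the standardized sum S, and w = (y1 + y2) / sqrt 2, which is standard
   normal; the pair (s, w) has the same covariance a = E[xy] as (x, y). Let phi be
   the standardized inverse of g: phi is nondecreasing, so is z - c phi(z) since
   g' >= c, and phi(Z) has the law of s for a standard normal Z.
   - The rearrangement inequality E[s theta(w)] <= E[phi(Z) theta(Z)] with
     theta(z) = z - c phi(z) says that the coupling (phi(Z), Z) improves on (s, w)
     by at least c E(s - phi(w))^2.
   - E[s phi(w)] = sqrt 2 E[x (T phi)(y)], where T is the Ornstein-Uhlenbeck
     operator of correlation 1 / sqrt 2. T contracts the orthogonal complement of
     the affine functions by 1 / 2, hence E(s - phi(w))^2 >= (1 - a^2) / 2.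
   This bounds D(S) by the desired function of the cost E(X - Y)^2 of the given
   coupling; take the infimum over the couplings. *)

Set Implicit Arguments.
Unset Strict Implicit.
Unset Printing Implicit Defensive.
Import Order.TTheory GRing.Theory Num.Theory.
Import numFieldNormedType.Exports.

Local Open Scope classical_set_scope.
Local Open Scope ring_scope.

(** * Square integrable functions *)

(** The factor 1 / 2 in the contraction is the square of the correlation: the eigenvalues of the
    operator are the powers of the correlation, and the affine functions carry the first two. No
    Hermite basis is used; the contraction is extracted from the explicit kernel, its composition
    law and its trace. The affine part of [phi] escapes this contraction. It is paired with the part
    of [x] along [y], which is how the covariance [a] enters the gain [(1 - a^2) / 2]. Two
    mismatches shape the end of the proof. First, [g] is built from [N(mu, sigma^2)], while the sum
    has mean [sqrt 2 mu]; this shifts [phi] by a constant, which standardization absorbs. *)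

Section square_integrable.
Context (R : realType) (d : measure_display) (T : measurableType d)
  (P : probability T R).
Implicit Types f g : T -> R.

Definition L1 f := P.-integrable setT (EFin \o f).

Definition L2 f := measurable_fun setT f /\ L1 (fun x => f x ^+ 2).

Lemma L1_measurable f : L1 f -> measurable_fun setT f.
Proof. by move=> /integrableP[/measurable_EFinP]. Qed.

Lemma L1D f g : L1 f -> L1 g -> L1 (fun x => f x + g x).
Proof. by move=> lf lg; exact: (integrableD measurableT lf lg). Qed.

Lemma L1Z k f : L1 f -> L1 (fun x => k * f x).
Proof. by move=> lf; exact: (integrableZl measurableT k lf). Qed.

Lemma L1B f g : L1 f -> L1 g -> L1 (fun x => f x - g x).
Proof. by move=> lf lg; exact: (integrableB measurableT lf lg). Qed.

Lemma L1_cst k : L1 (fun=> k).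
Proof. exact: (finite_measure_integrable_cst P k measurableT). Qed.

Lemma L1_le f g : measurable_fun setT f -> (forall x, `|f x| <= g x) ->
  L1 g -> L1 f.
Proof.
move=> mf fg lg; apply: (le_integrable measurableT _ _ lg).
  exact/measurable_EFinP.
by move=> x _ /=; rewrite lee_fin (le_trans (fg x))// ler_norm.
Qed.

Lemma eq_L1 f g : f =1 g -> L1 f -> L1 g.
Proof. by move=> /funext ->. Qed.

Lemma L1_ge0 f : measurable_fun setT f -> (forall x, 0 <= f x) ->
  (\int[P]_x (f x)%:E < +oo)%E -> L1 f.
Proof.
move=> mf f0 ioo; apply/integrableP; split; first exact/measurable_EFinP.
by under eq_integral => x _ do rewrite /= ger0_norm//.
Qed.

Lemma RintE f : L1 f -> (\int[P]_x (f x)%:E = (\int[P]_x f x)%:E)%E.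
Proof. by move=> lf; rewrite fineK//; exact: integrable_fin_num. Qed.

Lemma L2_L1M f g : L2 f -> L2 g -> L1 (fun x => f x * g x).
Proof.
move=> [mf f2] [mg g2].
apply: (@L1_le _ (fun x => f x ^+ 2 + g x ^+ 2)); last exact: L1D.
  exact: measurable_funM.
by move=> x; rewrite ler_norml; apply/andP; split; nra.
Qed.

Lemma L2_cst k : L2 (fun=> k).
Proof. by split; [exact: measurable_cst|exact: L1_cst]. Qed.

Lemma L2_L1 f : L2 f -> L1 f.
Proof.
move=> lf; apply: (eq_L1 _ (L2_L1M lf (L2_cst 1))) => x.
by rewrite mulr1.
Qed.

Lemma L2D f g : L2 f -> L2 g -> L2 (fun x => f x + g x).
Proof.
move=> lf lg; split; first by apply: measurable_funD; [case: lf|case: lg].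
apply: (@eq_L1 (fun x => f x ^+ 2 + (2 * (f x * g x) + g x ^+ 2))).
  by move=> x; ring.
apply: L1D; first by case: lf.
by apply: L1D; [apply: L1Z; exact: L2_L1M|case: lg].
Qed.

Lemma L2Z k f : L2 f -> L2 (fun x => k * f x).
Proof.
move=> lf; split; first by apply: measurable_funM => //; case: lf.
apply: (@eq_L1 (fun x => k ^+ 2 * f x ^+ 2)); first by move=> x; ring.
by apply: L1Z; case: lf.
Qed.

Lemma L2B f g : L2 f -> L2 g -> L2 (fun x => f x - g x).
Proof.
move=> lf lg; have := L2D lf (L2Z (-1) lg).
by under [X in L2 X -> _]eq_fun do rewrite mulN1r.
Qed.

Lemma L2_le f g : measurable_fun setT f -> (forall x, `|f x| <= g x) ->
  L2 g -> L2 f.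
Proof.
move=> mf fg [mg lg]; split => //.
apply: (L1_le _ _ lg) => [|x]; first exact: measurable_funX.
rewrite normrX lerXn2r// nnegrE//; exact: le_trans (fg x).
Qed.

Lemma eq_L2 f g : f =1 g -> L2 f -> L2 g.
Proof. by move=> /funext ->. Qed.

Lemma L2_norm f : L2 f -> L2 (fun x => `|f x|).
Proof.
move=> [mf lf]; split; first exact: measurableT_comp.
by apply: eq_L1 lf => x; rewrite real_normK// num_real.
Qed.

Lemma RintD f g : L1 f -> L1 g ->
  \int[P]_x (f x + g x) = \int[P]_x f x + \int[P]_x g x.
Proof. exact: RintegralD. Qed.

Lemma RintB f g : L1 f -> L1 g ->
  \int[P]_x (f x - g x) = \int[P]_x f x - \int[P]_x g x.
Proof. exact: RintegralB. Qed.

Lemma RintZ k f : L1 f -> \int[P]_x (k * f x) = k * \int[P]_x f x.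
Proof. exact: RintegralZl. Qed.

Lemma Rint_cst k : \int[P]_x k = k.
Proof.
by rewrite Rintegral_cst//= (_ : P _ = 1%E) ?mulr1//; exact: probability_setT.
Qed.

Lemma eq_Rint f g : f =1 g -> \int[P]_x f x = \int[P]_x g x.
Proof. by move=> fg; apply: eq_Rintegral => x _; rewrite fg. Qed.

Lemma le_Rint f g : L1 f -> L1 g -> (forall x, f x <= g x) ->
  \int[P]_x f x <= \int[P]_x g x.
Proof. by move=> lf lg fg; apply: le_Rintegral. Qed.

Lemma Rint_ge0 f : (forall x, 0 <= f x) -> 0 <= \int[P]_x f x.
Proof. by move=> f0; apply: Rintegral_ge0. Qed.

(* [0 <= int (f - t g) ^ 2] for all [t]. *)
Lemma cauchy_schwarz f g : L2 f -> L2 g ->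
  (\int[P]_x (f x * g x)) ^+ 2 <=
  (\int[P]_x (f x ^+ 2)) * (\int[P]_x (g x ^+ 2)).
Proof.
move=> lf lg.
set B := \int[P]_x (f x * g x); set F := \int[P]_x (f x ^+ 2).
set G := \int[P]_x (g x ^+ 2).
have H t : 0 <= F - (2 * t) * B + t ^+ 2 * G.
  have : 0 <= \int[P]_x ((f x - t * g x) ^+ 2).
    by apply: Rint_ge0 => x; exact: sqr_ge0.
  rewrite (@eq_Rint _ (fun x => (f x ^+ 2 - (2 * t) * (f x * g x)) +
                         t ^+ 2 * g x ^+ 2)); last by move=> x; ring.
  have l1 : L1 (fun x => f x ^+ 2) by case: lf.
  have l2 : L1 (fun x => g x ^+ 2) by case: lg.
  have l3 := L2_L1M lf lg.
  by rewrite RintD ?RintB ?RintZ//; [exact: L1Z|apply: L1B => //; exact: L1Z|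
    exact: L1Z].
have F0 : 0 <= F by apply: Rint_ge0 => x; exact: sqr_ge0.
have G0 : 0 <= G by apply: Rint_ge0 => x; exact: sqr_ge0.
move: G0; rewrite le_eqVlt => /predU1P[G0|G0].
  rewrite -G0 mulr0 in H *.
  have [->|B0] := eqVneq B 0; first by rewrite expr0n.
  (* For [G = 0] the quadratic is affine in [t], and at this [t] it equals [-1]. *)
  have := H ((F + 1) / (2 * B)).
  have -> : 2 * ((F + 1) / (2 * B)) * B = F + 1 by field.
  by rewrite mulr0 addr0 => h; exfalso; lra.
have := H (B / G); have -> : F - 2 * (B / G) * B + (B / G) ^+ 2 * G =
   (F * G - B ^+ 2) / G by field; exact: lt0r_neq0.
by rewrite pmulr_lge0 ?invr_gt0// subr_ge0.
Qed.

End square_integrable.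

(** * Random variables with the same law *)

Section same_law.
Context (R : realType) (d1 d2 d : measure_display) (T1 : measurableType d1)
  (T2 : measurableType d2) (T : measurableType d)
  (P : probability T1 R) (Q : probability T2 R).

(** Equality of laws across two probability spaces. With [Y] the identity it says that [X] has law
    [Q]; with [Y] a function on the line it represents a law as an image of [Q], as is done with
    [phi]. *)
Definition same_law (X : T1 -> T) (Y : T2 -> T) :=
  [/\ measurable_fun setT X, measurable_fun setT Y &
      forall A, measurable A -> P (X @^-1` A) = Q (Y @^-1` A)].

Variables (X : T1 -> T) (Y : T2 -> T).
Hypothesis XY : same_law X Y.

Let mX : measurable_fun setT X. Proof. by case: XY. Qed.
Let mY : measurable_fun setT Y. Proof. by case: XY. Qed.

Lemma same_law_ge0_integral (f : T -> \bar R) : measurable_fun setT f ->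
  (forall x, (0 <= f x)%E) ->
  (\int[P]_x f (X x) = \int[Q]_y f (Y y))%E.
Proof.
move=> mf f0.
have := @ge0_integral_pushforward _ _ _ _ _ _ mX P setT f measurableT mf
  (fun y _ => f0 y).
rewrite preimage_setT => <-.
have := @ge0_integral_pushforward _ _ _ _ _ _ mY Q setT f measurableT mf
  (fun y _ => f0 y).
rewrite preimage_setT => <-.
by apply: eq_measure_integral => /= A mA _; case: XY => _ _; exact.
Qed.

Lemma same_law_integral (f : T -> R) : measurable_fun setT f ->
  (\int[P]_x (f (X x))%:E = \int[Q]_y (f (Y y))%:E)%E.
Proof.
move=> /measurable_EFinP mf; pose F := EFin \o f.
have hp := same_law_ge0_integral (measurable_funepos mf) (funepos_ge0 _).
have hn := same_law_ge0_integral (measurable_funeneg mf) (funeneg_ge0 _).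
transitivity (\int[P]_x (F \o X) x)%E; first by [].
transitivity (\int[Q]_x (F \o Y) x)%E; last by [].
rewrite [LHS]integralE [RHS]integralE.
rewrite (funepos_comp F X) (funeneg_comp F X) (funepos_comp F Y)
  (funeneg_comp F Y).
exact: (congr2 (fun a b => a - b)%E hp hn).
Qed.

Lemma same_law_Rint (f : T -> R) : measurable_fun setT f ->
  \int[P]_x f (X x) = \int[Q]_y f (Y y).
Proof. by move=> mf; rewrite /Rintegral same_law_integral. Qed.

Lemma same_law_L1 (f : T -> R) : measurable_fun setT f ->
  L1 Q (f \o Y) -> L1 P (f \o X).
Proof.
move=> mf /integrableP[_ fi]; apply/integrableP; split.
  by apply/measurable_EFinP; exact: measurableT_comp.
apply: le_lt_trans fi.
by rewrite (same_law_integral (f := fun x => `|f x|))//; exact: measurableT_comp.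
Qed.

Lemma same_law_L2 (f : T -> R) : measurable_fun setT f ->
  L2 Q (f \o Y) -> L2 P (f \o X).
Proof.
move=> mf [_ f2]; split; first exact: measurableT_comp.
by apply: (@same_law_L1 (fun x => f x ^+ 2)) => //; exact: measurable_funX.
Qed.

End same_law.

Lemma same_law_sym (R : realType) (d1 d2 d : measure_display)
    (T1 : measurableType d1) (T2 : measurableType d2) (T : measurableType d)
    (P : probability T1 R) (Q : probability T2 R) (X : T1 -> T) (Y : T2 -> T) :
  same_law P Q X Y -> same_law Q P Y X.
Proof. by case=> mX mY XY; split=> // A mA; rewrite XY. Qed.

Lemma same_law_trans (R : realType) (d1 d2 d3 d : measure_display)
    (T1 : measurableType d1) (T2 : measurableType d2) (T3 : measurableType d3)
    (T : measurableType d)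
    (P : probability T1 R) (Q : probability T2 R) (U : probability T3 R)
    (X : T1 -> T) (Y : T2 -> T) (Z : T3 -> T) :
  same_law P Q X Y -> same_law Q U Y Z -> same_law P U X Z.
Proof. by case=> mX mY XY [_ mZ YZ]; split=> // A mA; rewrite XY// YZ. Qed.

Lemma same_law_comp (R : realType) (d1 d2 d d' : measure_display)
    (T1 : measurableType d1) (T2 : measurableType d2) (T : measurableType d)
    (T' : measurableType d')
    (P : probability T1 R) (Q : probability T2 R) (X : T1 -> T) (Y : T2 -> T)
    (f : T -> T') : measurable_fun setT f ->
  same_law P Q X Y -> same_law P Q (f \o X) (f \o Y).
Proof.
move=> mf [mX mY XY]; split=> [||A mA]; try exact: measurableT_comp.
apply: (XY (f @^-1` A)).
by rewrite -[X in measurable X]setTI; exact: mf.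
Qed.

Section fubini_real.
Context (R : realType) (d1 d2 : measure_display) (T1 : measurableType d1)
  (T2 : measurableType d2) (P : probability T1 R) (Q : probability T2 R).
Implicit Types f : T1 * T2 -> R.

Lemma L1_prod f : measurable_fun setT f ->
  (\int[P]_x \int[Q]_y `|f (x, y)|%:E < +oo)%E -> L1 (P \x Q)%E f.
Proof.
by move=> mf fi; apply/integrable12ltyP => //; exact/measurable_EFinP.
Qed.

(** Fubini by itself yields integrable sections almost everywhere. Asking for all of them makes the
    real inner integral agree with the extended one at every point, so no null set has to be carried
    along. *)
Lemma Rint_prod1 f : L1 (P \x Q)%E f -> (forall x, L1 Q (fun y => f (x, y))) ->
  \int[(P \x Q)%E]_z f z = \int[P]_x \int[Q]_y f (x, y).
Proof.
move=> lf lx; rewrite /Rintegral -(integral12_prod_meas1 lf).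
by congr fine; apply: eq_integral => x _; exact: (RintE (lx x)).
Qed.

Lemma Rint_prod2 f : L1 (P \x Q)%E f -> (forall y, L1 P (fun x => f (x, y))) ->
  \int[(P \x Q)%E]_z f z = \int[Q]_y \int[P]_x f (x, y).
Proof.
move=> lf lx; rewrite /Rintegral -(integral21_prod_meas1 lf).
by congr fine; apply: eq_integral => x _; exact: (RintE (lx x)).
Qed.

Lemma L1_fubini1 f : L1 (P \x Q)%E f -> (forall x, L1 Q (fun y => f (x, y))) ->
  L1 P (fun x => \int[Q]_y f (x, y)).
Proof.
move=> lf lx; have := integrable_fubini_F lf.
by rewrite (_ : fubini_F Q _ = EFin \o (fun x => \int[Q]_y f (x, y)))//; apply/funext => x; exact: (RintE (lx x)).
Qed.

End fubini_real.

(* The rays ]x, +oo[ form a pi-system that generates the Borel sets. *)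
Lemma eq_probability_cdf (R : realType) (m1 m2 : probability R R) :
  (forall x : R, m1 `]-oo, x]%classic = m2 `]-oo, x]%classic) ->
  forall A, measurable A -> m1 A = m2 A.
Proof.
move=> m12.
apply: (@measure_unique _ R R (@RGenOInfty.G R)
  (fun n => `](- n%:R)%R, +oo[%classic) _ _ _ _ m1 m2).
- exact: RGenOInfty.measurableE.
- move=> _ _ [x ->] [y ->]; exists (Num.max x y).
  by apply/seteqP; split => z /=; rewrite !in_itv/= !andbT gt_max; move/andP.
- by move=> n; exists (- n%:R).
- apply/seteqP; split => // x _ /=; exists (Num.trunc `|x|).+1 => //=.
  rewrite in_itv/= andbT ltrNl (le_lt_trans (ler_norm _))// normrN.
  by rewrite truncnS_gt.
- move=> _ [x ->]; rewrite -[`]x, +oo[%classic]setCK setCitvr.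
  have mx : measurable (`]-oo, x]%classic : set R).
    exact: measurable_itv.
  apply: (etrans (probability_setC m1 mx)).
  apply: (etrans _ (esym (probability_setC m2 mx))).
  exact: (congr1 (fun t => 1 - t)%E (m12 x)).
- by move=> n; rewrite -ge0_fin_numE// fin_num_measure.
Qed.

Lemma same_law_cdf (R : realType) (d1 d2 : measure_display)
    (T1 : measurableType d1) (T2 : measurableType d2) (P : probability T1 R)
    (Q : probability T2 R) (X : T1 -> R) (Y : T2 -> R) :
  measurable_fun setT X -> measurable_fun setT Y ->
  (forall x, P [set t | X t <= x] = Q [set t | Y t <= x]) ->
  same_law P Q X Y.
Proof.
move=> mX mY XY; split=> //.
pose X' : {mfun T1 >-> R} := mfun_Sub (mem_set mX).
pose Y' : {mfun T2 >-> R} := mfun_Sub (mem_set mY).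
suff H (x : R) : distribution P X' `]-oo, x]%classic =
    distribution Q Y' `]-oo, x]%classic.
  by move=> A; exact: (@eq_probability_cdf R (distribution P X') (distribution Q Y') H A).
rewrite /distribution /pushforward.
have E (T : Type) (f : T -> R) : f @^-1` `]-oo, x]%classic = [set t | f t <= x].
  by apply/seteqP; split => t /=; rewrite in_itv.
by rewrite !E XY.
Qed.

(** * Normal laws: integration against the density, reduction to the standard law *)

Section normal.
Context (R : realType).
Implicit Types m s x y z : R.
Local Notation mu := (@lebesgue_measure R).

(** The measure is given by its values on sets; the density enters through the Radon-Nikodym
    derivative, which agrees with [normal_pdf] almost everywhere. *)
Lemma ge0_integral_normal_prob m s (f : R -> \bar R) :
  measurable_fun setT f -> (forall x, 0 <= f x)%E ->
  (\int[normal_prob m s]_x f x = \int[mu]_x (f x * (normal_pdf m s x)%:E))%E.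
Proof.
move=> mf f0; have dom := normal_prob_dominates m s.
rewrite -(Radon_Nikodym_SigmaFinite.change_of_variables dom)//.
apply: ae_eq_integral => //.
- apply: emeasurable_funM => //; apply: measurable_int.
  exact: Radon_Nikodym_SigmaFinite.f_integrable.
- by apply: emeasurable_funM => //; apply/measurable_EFinP;
    exact: measurable_normal_pdf.
- apply: ae_eqe_mul2l; apply: integral_ae_eq => //.
  + exact: Radon_Nikodym_SigmaFinite.f_integrable.
  + by apply/measurable_EFinP; exact: measurable_normal_pdf.
  + by move=> E _ mE; rewrite -Radon_Nikodym_SigmaFinite.f_integral.
Qed.

Lemma normal_pdf_std s m z : 0 < s ->
  normal_pdf m s z = s^-1 * normal_pdf 0 1 ((z - m) / s).
Proof.
move=> s0; rewrite !normal_pdfE ?oner_eq0 ?gt_eqF// /normal_peak /normal_fun.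
rewrite mulrA; congr (_ * expR _); last by field; rewrite gt_eqF.
rewrite expr1n mul1r -mulrnAr sqrtrM ?sqr_ge0// sqrtr_sqr gtr0_norm//.
by rewrite invfM.
Qed.

(** The distribution functions are compared by the substitution [x -> (x - m) / s] on a left
    half-line. *)
Lemma normal_prob_affine m s : 0 < s ->
  same_law (normal_prob m s) (normal_prob 0 1) id (fun z : R => m + s * z).
Proof.
move=> s0; have sN0 : s != 0 by rewrite gt_eqF.
apply: same_law_cdf => // [|u].
  by apply: measurable_funD => //; exact: measurable_funM.
have -> : [set t | id t <= u] = `]-oo, u]%classic.
  by apply/seteqP; split => t /=; rewrite in_itv.
pose F : R -> R := fun x => (x - m) / s.
have -> : [set t | m + s * t <= u] = `]-oo, F u]%classic.
  apply/seteqP; split => t /=; rewrite in_itv/= /F.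
    by rewrite -lerBrDl ler_pdivlMr// mulrC.
  by rewrite ler_pdivlMr// -lerBrDl mulrC.
have F'E : F^`()%classic = cst s^-1.
  apply/funext => x; rewrite /F derive1E deriveM// deriveD// derive_cst scaler0.
  by rewrite add0r derive_id derive_cst addr0 scaler1.
rewrite /normal_prob.
apply: (etrans _ (esym (@increasing_ge0_integration_by_substitutionNy R F
  (normal_pdf 0 1) u _ _ _ _ _ _ _ _))).
- apply: eq_integral => x _; rewrite /= F'E normal_pdf_std// /F.
  by rewrite mulrC.
- by move=> x y _ _ xy; rewrite /F ltr_pM2r ?invr_gt0// ltrD2r.
- by rewrite F'E => x _; exact: cvg_cst.
- by rewrite F'E; exact: is_cvg_cst.
- by rewrite F'E; exact: cvg_cst.
- split => [x _|]; first by rewrite /F.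
  apply: cvg_at_left_filter; apply: differentiable_continuous.
  by apply/derivable1_diffP; rewrite /F.
- apply/gt0_cvgMlNy; last exact: cvg_addrr_Ny.
  by rewrite invr_gt0.
- by apply: continuous_subspaceT; apply: continuous_normal_pdf; exact: oner_neq0.
- by move=> x _; exact: normal_pdf_ge0.
Qed.

End normal.

(** * The standard normal law *)

Section gauss.
Context (R : realType).
Implicit Types r v x y z b : R.
Local Notation mu := (@lebesgue_measure R).

Definition gauss : probability (measurableTypeR R) R := normal_prob 0 1.

(** Completing the square: against the standard density the integrand is a multiple of the density
    of [N(v b, v)]. The range [v > 0] covers exactly the quadratic coefficients with a finite
    integral. The moments, the composition of kernels and the trace are all derived from this
    formula. *)
Lemma gauss_expE v b : 0 < v ->
  (\int[gauss]_z (expR ((1 - v^-1) / 2 * z ^+ 2 + b * z))%:E =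
   (Num.sqrt v * expR (v * b ^+ 2 / 2))%:E)%E.
Proof.
move=> v0; have vN0 : v != 0 by rewrite gt_eqF.
have s0 : 0 < Num.sqrt v by rewrite sqrtr_gt0.
rewrite ge0_integral_normal_prob; last 2 first.
- apply/measurable_EFinP; apply: measurableT_comp => //.
  apply: measurable_funD; apply: measurable_funM => //.
- by move=> x; rewrite lee_fin expR_ge0.
transitivity (\int[mu]_x ((Num.sqrt v * expR (v * b ^+ 2 / 2))%:E *
    (normal_pdf (v * b) (Num.sqrt v) x)%:E))%E.
  apply: eq_integral => x _; rewrite -!EFinM; congr EFin.
  rewrite (normal_pdf_std (v * b) x s0).
  have pdf1 z : normal_pdf 0 1 z = normal_peak 1 * expR (- z ^+ 2 / 2).
    rewrite normal_pdfE ?oner_eq0// /normal_fun subr0 expr1n.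
    by congr (_ * expR _); field.
  rewrite !pdf1; set p := normal_peak 1.
  rewrite [LHS]mulrCA.
 rewrite -[in LHS]expRD.
  transitivity (p * (expR (v * b ^+ 2 / 2) *
    expR (- ((x - v * b) / Num.sqrt v) ^+ 2 / 2))); last first.
    by field; rewrite gt_eqF.
  rewrite -[in RHS]expRD exprMn exprVn sqr_sqrtr ?ltW//.
  by congr (p * expR _); field.
rewrite ge0_integralZl//; last 2 first.
- by apply/measurable_EFinP; exact: measurable_normal_pdf.
- by move=> x _; rewrite lee_fin normal_pdf_ge0.
by rewrite integral_normal_pdf mule1.
Qed.

Lemma gauss_exp_L1 v b : 0 < v ->
  L1 gauss (fun z => expR ((1 - v^-1) / 2 * z ^+ 2 + b * z)).
Proof.
move=> v0; apply: L1_ge0.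
- apply: measurableT_comp => //.
  by apply: measurable_funD; apply: measurable_funM.
- by move=> x; exact: expR_ge0.
- by rewrite gauss_expE// ltry.
Qed.

Lemma gauss_exp v b : 0 < v ->
  \int[gauss]_z (expR ((1 - v^-1) / 2 * z ^+ 2 + b * z)) =
   Num.sqrt v * expR (v * b ^+ 2 / 2).
Proof. by move=> v0; rewrite /Rintegral gauss_expE. Qed.

Lemma gauss_id_L2 : L2 gauss id.
Proof.
split => //.
(* For [v = 4] the quadratic coefficient is [3 / 8], and [1 + t <= exp t] gives
   [x^2 <= (8 / 3) exp (3 x^2 / 8)]. *)
have v0 : (0 : R) < 4 by [].
apply: (L1_le _ _ (L1Z (8 / 3) (gauss_exp_L1 0 v0))).
- exact: measurable_funX.
- move=> x; rewrite ger0_norm ?sqr_ge0//.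
  have := expR_ge1Dx ((1 - 4^-1) / 2 * x ^+ 2 + 0 * x); lra.
Qed.

(** A first-order argument: [1 + b z <= exp (b z)] gives [b m <= exp (b^2 / 2) - 1 <= b^2] for
    [|b| <= 1], and small [b] of the sign of [m] then force [m = 0]. *)
Lemma gauss_mean : \int[gauss]_z z = 0.
Proof.
set m := \int[gauss]_z z.
have lid : L1 gauss id := L2_L1 gauss_id_L2.
have H b : b * m <= expR (b ^+ 2 / 2) - 1.
  have := @gauss_exp 1 b ltr01; rewrite sqrtr1 !mul1r => <-.
  rewrite lerBrDl -{1}(Rint_cst gauss 1) -RintZ// -RintD//; [|exact: L1_cst|exact: L1Z].
  apply: le_Rint => [||x].
  - by apply: L1D; [exact: L1_cst|exact: L1Z].
  - exact: gauss_exp_L1.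
  - by have := expR_ge1Dx ((1 - 1^-1) / 2 * x ^+ 2 + b * x); lra.
have K b : `|b| <= 1 -> b * m <= b ^+ 2.
  move=> b1; apply: (le_trans (H b)).
  have b2 : b ^+ 2 <= 1 by rewrite -real_normK ?num_real// expr_le1.
  have := expR_ge1Dx (- (b ^+ 2 / 2)); rewrite expRN => h.
  have e0 : 0 < expR (b ^+ 2 / 2) by exact: expR_gt0.
  have : (1 - b ^+ 2 / 2) * expR (b ^+ 2 / 2) <= 1.
    by rewrite -ler_pdivlMr// div1r.
  have b20 := sqr_ge0 b.
  nra.
have [m0|m0|//] := ltgtP m 0.
  have [m1|m1] := leP m (-1).
    have := K (- 2^-1); rewrite normrN ger0_norm ?invr_ge0// => /(_ _); nra.
  have := K (m / 2); rewrite ltr0_norm; [|lra]; nra.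
have [m1|m1] := leP 1 m.
  have := K (2^-1); rewrite ger0_norm ?invr_ge0// => /(_ _); nra.
have := K (m / 2); rewrite gtr0_norm; [|lra]; nra.
Qed.

(** The same method with [exp ((1 - r^2) z^2 / 2)], whose integral is [1 / r], and with [r] near 1
    on either side. *)
Lemma gauss_var : \int[gauss]_z (z ^+ 2) = 1.
Proof.
set m := \int[gauss]_z (z ^+ 2).
have [_ l2] : L2 gauss id := gauss_id_L2.
have m0 : 0 <= m by apply: Rint_ge0 => x; exact: sqr_ge0.
have H r : 0 < r -> (1 - r ^+ 2) / 2 * m <= r^-1 - 1.
  move=> r0; have r20 : 0 < (r ^+ 2)^-1 by rewrite invr_gt0 exprn_gt0.
  have := @gauss_exp ((r ^+ 2)^-1) 0 r20.
  rewrite expr0n/= mulr0 mul0r expR0 mulr1 sqrtrV ?sqr_ge0// sqrtr_sqr gtr0_norm//.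
  move=> <-; rewrite lerBrDl -{1}(Rint_cst gauss 1) -RintZ// -RintD//;
    [|exact: L1_cst|exact: L1Z].
  apply: le_Rint => [||x].
  - by apply: L1D; [exact: L1_cst|exact: L1Z].
  - exact: gauss_exp_L1.
  - rewrite invrK.
    by have := expR_ge1Dx ((1 - r ^+ 2) / 2 * x ^+ 2 + 0 * x); lra.
have K r : 0 < r -> (1 - r) * (r * (1 + r) * m) <= (1 - r) * 2.
  move=> r0; have := H r r0.
  rewrite -(ler_pM2l (_ : 0 < 2 * r)); last by rewrite mulr_gt0.
  by have e : r * r^-1 = 1 by [rewrite divff ?gt_eqF]; nra.
(* [K] bounds [r (1 + r) m] by 2, from above for [r < 1] and from below for [r > 1]; [r] is taken so
   close to 1 that this contradicts the assumed side of [m]. *)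
have [m1|m1|//] := ltgtP m 1.
  have := K (1 + (1 - m) / 4); rewrite (_ : 1 - (1 + (1 - m) / 4) = - ((1 - m) / 4)); [|ring].
  rewrite !mulNr lerN2 ler_pM2l; [|lra].
  by move=> /(_ _); nra.
have e0 : 0 < (m - 1) / (3 * m) by rewrite divr_gt0 ?subr_gt0// mulr_gt0//; lra.
have e1 : 3 * m * ((m - 1) / (3 * m)) = m - 1 by field; rewrite gt_eqF//; lra.
set e := (m - 1) / (3 * m) in e0 e1.
have e2 : e < 1 by nra.
have := K (1 - e); rewrite (_ : 1 - (1 - e) = e); [|ring].
rewrite ler_pM2l// subr_gt0 => /(_ e2); nra.
Qed.

End gauss.

(** * The Mehler kernel *)

Section mehler.
Context (R : realType).
Implicit Types r v x y z b : R.
Local Notation mu := (@lebesgue_measure R).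
Local Notation gauss := (gauss R).
Local Notation gR := (measurableTypeR R).

(** Density, with respect to the product of two standard normal laws, of a pair of standard normal
    variables with correlation [r]. *)
Definition mehler r x y : R := (Num.sqrt (1 - r ^+ 2))^-1 *
  expR ((2 * r * x * y - r ^+ 2 * (x ^+ 2 + y ^+ 2)) / (2 * (1 - r ^+ 2))).

Lemma mehlerC r x y : mehler r x y = mehler r y x.
Proof. by rewrite /mehler (addrC (x ^+ 2)) mulrAC. Qed.

Lemma mehler_ge0 r x y : 0 <= mehler r x y.
Proof. by rewrite mulr_ge0 ?expR_ge0// invr_ge0 sqrtr_ge0. Qed.

Lemma measurable_mehler r :
  measurable_fun setT (fun p : gR * gR => mehler r p.1 p.2).
Proof.
apply: measurable_funM => //; apply: measurableT_comp => //.
apply: measurable_funM => //; apply: measurable_funB; apply: measurable_funM => //.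
  by apply: measurable_funM.
by apply: measurable_funD; apply: measurable_funX.
Qed.

Lemma measurable_mehler1 r x : measurable_fun setT (fun y : gR => mehler r x y).
Proof.
apply: measurable_funM => //; apply: measurableT_comp => //.
apply: measurable_funM => //; apply: measurable_funB; apply: measurable_funM => //.
by apply: measurable_funD.
Qed.

Section param.
Variable r : R.
Hypotheses (r0 : 0 < r) (r1 : r < 1).

Let r2 : 0 < 1 - r ^+ 2.
Proof. by rewrite subr_gt0 expr_lt1// ltW. Qed.

Let r2N0 : 1 - r ^+ 2 != 0. Proof. by rewrite gt_eqF. Qed.

Let r2' : 0 < 1 + r ^+ 2.
Proof. by rewrite ltr_wpDr ?sqr_ge0. Qed.

Let r2N0' : 1 + r ^+ 2 != 0. Proof. by rewrite gt_eqF. Qed.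

Let s0 : 0 < Num.sqrt (1 - r ^+ 2). Proof. by rewrite sqrtr_gt0. Qed.

Lemma mehler_convE x y z : mehler r x z * mehler r z y =
  ((1 - r ^+ 2)^-1 * expR (- (r ^+ 2 * (x ^+ 2 + y ^+ 2)) / (2 * (1 - r ^+ 2)))) *
  expR ((1 - ((1 - r ^+ 2) / (1 + r ^+ 2))^-1) / 2 * z ^+ 2 +
    (r * (x + y) / (1 - r ^+ 2)) * z).
Proof.
rewrite /mehler mulrACA -invfM -expr2 sqr_sqrtr ?ltW// -[RHS]mulrA -!expRD.
by congr (_ * expR _); field; apply/andP.
Qed.

Lemma mehler_conv_L1 x y : L1 gauss (fun z => mehler r x z * mehler r z y).
Proof.
under eq_fun do rewrite mehler_convE.
by apply: L1Z; apply: gauss_exp_L1; rewrite divr_gt0.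
Qed.

(** Correlations multiply along a Gaussian Markov chain: the semigroup law. In [z] the integrand is
    a Gaussian exponential with [v = (1 - r^2) / (1 + r^2)]. *)
Lemma mehler_conv x y :
  \int[gauss]_z (mehler r x z * mehler r z y) = mehler (r ^+ 2) x y.
Proof.
have v0 : 0 < (1 - r ^+ 2) / (1 + r ^+ 2) by rewrite divr_gt0.
under eq_Rint do rewrite mehler_convE.
rewrite RintZ; last exact: gauss_exp_L1.
rewrite gauss_exp// mulrACA -expRD /mehler; congr (_ * expR _); last first.
  have r4 : 1 - (r ^+ 2) ^+ 2 != 0.
    by rewrite (_ : _ - _ = (1 - r ^+ 2) * (1 + r ^+ 2)) ?mulf_neq0//; ring.
  by field; exact/and3P.
rewrite (_ : 1 - (r ^+ 2) ^+ 2 = (1 - r ^+ 2) * (1 + r ^+ 2)); last by ring.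
rewrite !sqrtrM ?ltW// sqrtrV ?ltW// invfM.
rewrite -[X in X^-1 * (_ * _)](sqr_sqrtr (ltW r2)).
by field; rewrite !gt_eqF//= sqrtr_gt0.
Qed.

Lemma mehler_L2 x : L2 gauss (mehler r x).
Proof.
split; first exact: measurable_mehler1.
by apply: eq_L1 (mehler_conv_L1 x x) => y; rewrite (mehlerC r y x) expr2.
Qed.

Lemma mehler_traceE x : mehler r x x =
  (Num.sqrt (1 - r ^+ 2))^-1 *
  expR ((1 - ((1 + r) / (1 - r))^-1) / 2 * x ^+ 2 + 0 * x).
Proof.
have n1 : 1 - r != 0 by rewrite subr_eq0 gt_eqF.
have n2 : 1 + r != 0 by rewrite gt_eqF// addr_gt0.
congr (_ * expR _); field.
by apply/and3P; split.
Qed.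

Lemma mehler_trace_L1 : L1 gauss (fun x => mehler r x x).
Proof.
under eq_fun do rewrite mehler_traceE.
by apply: L1Z; apply: gauss_exp_L1; rewrite divr_gt0 ?subr_gt0// addr_gt0.
Qed.

(** This is the sum of the eigenvalues [1, r, r^2, ...], obtained by integrating along the diagonal
    with [v = (1 + r) / (1 - r)]. *)
Lemma mehler_trace : \int[gauss]_x (mehler r x x) = (1 - r)^-1.
Proof.
have n1 : 0 < 1 - r by rewrite subr_gt0.
have n2 : 0 < 1 + r by rewrite addr_gt0.
have v0 : 0 < (1 + r) / (1 - r) by rewrite divr_gt0.
under eq_Rint do rewrite mehler_traceE.
rewrite RintZ; last exact: gauss_exp_L1.
rewrite gauss_exp// expr0n/= mulr0 mul0r expR0 mulr1.
rewrite (_ : 1 - r ^+ 2 = (1 + r) * (1 - r)); last by ring.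
rewrite !sqrtrM ?ltW// sqrtrV ?ltW//.
rewrite -[X in _ = X^-1](sqr_sqrtr (ltW n1)).
by field; rewrite !gt_eqF//= sqrtr_gt0.
Qed.

(** Given that the first variable of the correlated pair is [x], the second one has law
    [N(r x, 1 - r^2)]. *)
Lemma mehler_pdf x y : mehler r x y * normal_pdf 0 1 y =
  normal_pdf (r * x) (Num.sqrt (1 - r ^+ 2)) y.
Proof.
rewrite (normal_pdf_std (r * x) y s0).
have pdf1 z : normal_pdf 0 1 z = normal_peak 1 * expR (- z ^+ 2 / 2).
  rewrite normal_pdfE ?oner_eq0// /normal_fun subr0 expr1n.
  by congr (_ * expR _); field.
rewrite !pdf1 /mehler mulrACA [RHS]mulrA -[in LHS]expRD.
congr (_ * expR _).
rewrite exprMn exprVn sqr_sqrtr ?ltW//; field.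
by [].
Qed.

Lemma ge0_mehler_law (f : R -> R) x : measurable_fun setT f ->
  (forall y, 0 <= f y) ->
  (\int[gauss]_y (mehler r x y * f y)%:E =
   \int[gauss]_z (f (r * x + Num.sqrt (1 - r ^+ 2) * z))%:E)%E.
Proof.
move=> mf f0.
rewrite -(same_law_integral (normal_prob_affine (r * x) s0) mf).
rewrite !ge0_integral_normal_prob.
- apply: eq_integral => y _; rewrite -!EFinM; congr EFin.
  by rewrite -mehler_pdf; ring.
- exact/measurable_EFinP.
- by move=> y; rewrite lee_fin.
- apply/measurable_EFinP; apply: measurable_funM => //.
  exact: measurable_mehler1.
- by move=> y; rewrite lee_fin mulr_ge0// mehler_ge0.
Qed.

(** Conditional expectation of [f] at the second variable, given that the first is [x]. The kernel
    form exhibits the symmetry and allows Cauchy-Schwarz at each [x]; [ouE] recovers the averaging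
    form. *)
Definition ou (f : R -> R) x := \int[gauss]_y (mehler r x y * f y).

Lemma ou_L1 (f : R -> R) x : L2 gauss f -> L1 gauss (fun y => mehler r x y * f y).
Proof. by move=> lf; apply: L2_L1M => //; exact: mehler_L2. Qed.

(** True at every [x], since each kernel section is square integrable. It later supplies the
    everywhere integrable sections for Fubini. *)
Lemma mehler_law_L1 (f : R -> R) x : L2 gauss f ->
  L1 gauss (fun z => f (r * x + Num.sqrt (1 - r ^+ 2) * z)).
Proof.
move=> lf; have [mf _] := lf.
have maff : measurable_fun setT
    (fun z : R => r * x + Num.sqrt (1 - r ^+ 2) * z).
  by apply: measurable_funD => //; exact: measurable_funM.
have lfa := ou_L1 x (L2_norm lf).
suff la : L1 gauss (fun z => `|f (r * x + Num.sqrt (1 - r ^+ 2) * z)|).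
  by apply: (L1_le _ _ la) => //; exact: (measurableT_comp mf).
apply: L1_ge0 => //.
  by apply: measurableT_comp => //; exact: (measurableT_comp mf).
rewrite -(@ge0_mehler_law (fun y => `|f y|))//; last exact: measurableT_comp.
by rewrite (RintE lfa) ltry.
Qed.

Lemma ouE (f : R -> R) x : L2 gauss f ->
  ou f x = \int[gauss]_z f (r * x + Num.sqrt (1 - r ^+ 2) * z).
Proof.
move=> lf; have [mf _] := lf; have la := L2_norm lf; have [ma _] := la.
have lb : L2 gauss (fun x => `|f x| - f x) by exact: L2B.
have [mb _] := lb.
transitivity (ou (fun x => `|f x|) x - ou (fun x => `|f x| - f x) x).
  by rewrite /ou -RintB; [apply: eq_Rint => y; ring|exact: ou_L1..].
rewrite /ou /Rintegral !ge0_mehler_law//; last first.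
  by move=> y; rewrite subr_ge0 ler_norm.
rewrite -!/(Rintegral _ _ _) -RintB.
- by apply: eq_Rint => y; ring.
- exact: (mehler_law_L1 x la).
- exact: (mehler_law_L1 x lb).
Qed.

Lemma ou_cst c x : ou (fun=> c) x = c.
Proof. by rewrite ouE ?Rint_cst//; exact: L2_cst. Qed.

Lemma ou_id x : ou id x = r * x.
Proof.
have l1 : L1 gauss id := L2_L1 (gauss_id_L2 R).
rewrite ouE; last exact: gauss_id_L2.
rewrite RintD ?Rint_cst ?RintZ ?gauss_mean ?mulr0 ?addr0//.
- exact: L1_cst.
- exact: L1Z.
Qed.

End param.

End mehler.

(** * Contraction of the Ornstein-Uhlenbeck operator *)

Section contraction.
Context (R : realType).
Implicit Types (r x y z : R) (f h : R -> R).
Local Notation gauss := (gauss R).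
Local Notation gR := (measurableTypeR R).

Section param.
Variable r : R.
Hypotheses (r0 : 0 < r) (r1 : r < 1).

Let rr0 : 0 < r ^+ 2. Proof. exact: exprn_gt0. Qed.
Let rr1 : r ^+ 2 < 1. Proof. by rewrite expr_lt1// ltW. Qed.

(** Cauchy-Schwarz in [y]; by composition the kernel section has squared norm [mehler (r ^+ 2) x x].
    This diagonal is integrable, which puts [ou r f] in [L2]. *)
Lemma ou_sqr_le f x : L2 gauss f ->
  ou r f x ^+ 2 <= mehler (r ^+ 2) x x * \int[gauss]_y (f y ^+ 2).
Proof.
move=> lf; apply: le_trans (cauchy_schwarz (mehler_L2 r0 r1 x) lf) _.
rewrite -(mehler_conv r0 r1); under eq_Rint do rewrite expr2.
by under [in X in _ <= X]eq_Rint do rewrite (mehlerC r _ x).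
Qed.

Lemma mehler_kernel_measurable f h : measurable_fun setT f -> measurable_fun setT h ->
  measurable_fun setT (fun p : gR * gR => h p.1 * (mehler r p.1 p.2 * f p.2)).
Proof.
move=> mf mh; apply: measurable_funM.
  exact: (measurableT_comp mh measurable_fst).
apply: measurable_funM; first exact: measurable_mehler.
exact: (measurableT_comp mf measurable_snd).
Qed.

(** Makes [ou r f] measurable through Fubini. Integrating the absolute value in [x] first leaves the
    integral of [|f|], as the kernel has mass one. The factor [1] is the constant [h] of
    [mehler_kernel_measurable]. *)
Lemma ou_abs_L1 f : L2 gauss f ->
  L1 (gauss \x gauss)%E (fun p : gR * gR => 1 * (mehler r p.1 p.2 * f p.2)).
Proof.
move=> lf; have [mf _] := lf.
have mk := @mehler_kernel_measurable f (fun=> 1) mf (measurable_cst _).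
apply/integrable21ltyP; first exact/measurable_EFinP.
rewrite [X in (X < _)%E](_ : _ = \int[gauss]_y (`|f y|)%:E)%E; last first.
  apply: eq_integral => y _ /=.
  transitivity (\int[gauss]_x ((`|f y| * mehler r y x)%:E))%E.
    apply: eq_integral => x _; congr EFin.
    by rewrite mul1r normrM (ger0_norm (mehler_ge0 _ _ _)) mulrC mehlerC.
  have lm := L2_L1 (mehler_L2 r0 r1 y).
  rewrite (RintE (L1Z _ lm)) RintZ//; congr EFin.
  have := ou_cst r0 r1 1 y; rewrite /ou => h.
  rewrite [X in _ * X](_ : _ = 1) ?mulr1// -[RHS]h.
  by apply: eq_Rint => z; rewrite mulr1.
by rewrite (RintE (L2_L1 (L2_norm lf))) ltry.
Qed.

Lemma ou_L2 f : L2 gauss f -> L2 gauss (ou r f).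
Proof.
move=> lf; have mo : measurable_fun setT (ou r f).
  have lx x : L1 gauss (fun y => 1 * (mehler r x y * f y)).
    by apply: L1Z; exact: ou_L1.
  have := L1_measurable (L1_fubini1 (ou_abs_L1 lf) lx).
  congr measurable_fun; apply/funext => x.
  by apply: eq_Rint => y; rewrite mul1r.
split => //.
have lt := L1Z (\int[gauss]_y (f y ^+ 2)) (mehler_trace_L1 rr0 rr1).
apply: (L1_le _ _ lt); first exact: measurable_funX.
by move=> x; rewrite ger0_norm ?sqr_ge0// mulrC; exact: ou_sqr_le.
Qed.

Lemma ou_pairing_L1 f h : L2 gauss f -> L2 gauss h ->
  L1 (gauss \x gauss)%E (fun p : gR * gR => h p.1 * (mehler r p.1 p.2 * f p.2)).
Proof.
move=> lf lh; have [mf _] := lf; have [mh _] := lh.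
apply: L1_prod; first exact: mehler_kernel_measurable.
have lof := ou_L2 (L2_norm lf).
rewrite [X in (X < _)%E](_ : _ =
    \int[gauss]_x (`|h x| * ou r (fun y => `|f y|) x)%:E)%E; last first.
  apply: eq_integral => x _ /=.
  transitivity (\int[gauss]_y ((`|h x| * (mehler r x y * `|f y|))%:E))%E.
    apply: eq_integral => y _; congr EFin.
    by rewrite normrM (normrM (mehler r x y)) (ger0_norm (mehler_ge0 _ _ _)).
  have lm := ou_L1 r0 r1 x (L2_norm lf).
  by rewrite (RintE (L1Z _ lm)) RintZ.
by rewrite (RintE (L2_L1M (L2_norm lh) lof)) ltry.
Qed.

Lemma ou_selfadjoint f h : L2 gauss f -> L2 gauss h ->
  \int[gauss]_x (h x * ou r f x) = \int[gauss]_x (ou r h x * f x).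
Proof.
move=> lf lh; have lp := ou_pairing_L1 lf lh.
transitivity (\int[gauss]_x \int[gauss]_y (h x * (mehler r x y * f y))).
  by apply: eq_Rint => x; rewrite RintZ//; exact: ou_L1.
rewrite -(Rint_prod1 lp) => [|x]; last exact: (L1Z (h x) (ou_L1 r0 r1 x lf)).
rewrite (Rint_prod2 lp) => [|y].
  apply: eq_Rint => y /=.
  transitivity (\int[gauss]_x (f y * (mehler r y x * h x))).
    by apply: eq_Rint => x; rewrite (mehlerC r x y); ring.
  by rewrite RintZ ?(mulrC (f y))//; exact: ou_L1.
apply: (eq_L1 _ (L1Z (f y) (ou_L1 r0 r1 y lh))) => x.
by rewrite /= (mehlerC r x y); ring.
Qed.

(** Self-adjointness moves one operator onto the kernel section [mehler r x], which spares a second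
    exchange of integrals. *)
Lemma ou_ou f x : L2 gauss f -> ou r (ou r f) x = ou (r ^+ 2) f x.
Proof.
move=> lf; rewrite /ou (ou_selfadjoint lf (mehler_L2 r0 r1 x)).
apply: eq_Rint => y; congr (_ * _).
rewrite -mehler_conv//; apply: eq_Rint => z.
by rewrite mulrC (mehlerC r y z).
Qed.

(** The squared norm of [ou r f] is the pairing of [f] with [ou (r ^+ 2) f], to which Cauchy-Schwarz
    applies. *)
Lemma ou_norm_sqr_le f : L2 gauss f ->
  (\int[gauss]_x (ou r f x ^+ 2)) ^+ 2 <=
  (\int[gauss]_x (f x ^+ 2)) * \int[gauss]_x (ou (r ^+ 2) f x ^+ 2).
Proof.
move=> lf; have lof := ou_L2 lf.
have lo2 : L2 gauss (ou (r ^+ 2) f).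
  apply: (eq_L2 _ (ou_L2 lof)) => x; exact: ou_ou.
have -> : \int[gauss]_x (ou r f x ^+ 2) = \int[gauss]_x (f x * ou (r ^+ 2) f x).
  transitivity (\int[gauss]_x (ou r f x * ou r f x)).
    by apply: eq_Rint => x; rewrite expr2.
  rewrite (ou_selfadjoint lf lof).
  by apply: eq_Rint => x; rewrite (ou_ou x lf) mulrC.
exact: (cauchy_schwarz lf lo2).
Qed.

(* Hilbert-Schmidt bound: on functions orthogonal to [1] and [id], the kernel
   [mehler r x y] can be replaced by [mehler r x y - 1 - r x y]. *)
Lemma ou_hilbert_schmidt f : L2 gauss f ->
  \int[gauss]_x f x = 0 -> \int[gauss]_x (x * f x) = 0 ->
  \int[gauss]_x (ou r f x ^+ 2) <=
  r ^+ 4 / (1 - r ^+ 2) * \int[gauss]_x (f x ^+ 2).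
Proof.
move=> lf f0 f1; set F := \int[gauss]_x (f x ^+ 2).
have lid := gauss_id_L2 R.
(* The right-hand factor is the squared norm in [y] of the reduced kernel; its integral over [x] is
   [1 / (1 - r^2) - 1 - r^2 = r^4 / (1 - r^2)]. *)
have H x : ou r f x ^+ 2 <= F * (mehler (r ^+ 2) x x - 1 - r ^+ 2 * x ^+ 2).
  have lm := mehler_L2 r0 r1 x.
  have lk : L2 gauss (fun y => mehler r x y - (1 + r * x * y)).
    by apply: L2B => //; apply: L2D; [exact: L2_cst|exact: L2Z].
  have -> : ou r f x = \int[gauss]_y ((mehler r x y - (1 + r * x * y)) * f y).
    rewrite (_ : \int[gauss]_y _ = \int[gauss]_y (mehler r x y * f y -
        (f y + r * x * (y * f y)))); last by apply: eq_Rint => y; ring.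
    have l1 : L1 gauss (fun y => r * x * (y * f y)) by apply/L1Z/L2_L1M.
    rewrite RintB; [|exact: ou_L1|by apply: L1D => //; exact: L2_L1].
    rewrite RintD//; last exact: L2_L1.
    by rewrite RintZ ?f0 ?f1; [rewrite mulr0 addr0 subr0|exact: L2_L1M].
  rewrite (mulrC F); apply: le_trans (cauchy_schwarz lk lf) _.
  rewrite ler_wpM2r//; first by apply: Rint_ge0 => y; exact: sqr_ge0.
  rewrite (_ : \int[gauss]_y _ = \int[gauss]_y (((mehler r x y * mehler r y x
      - 2 * (mehler r x y * 1)) - (2 * r * x) * (mehler r x y * y)) +
      ((1 + (2 * r * x) * y) + (r * x) ^+ 2 * y ^+ 2))); last first.
    by apply: eq_Rint => y; rewrite (mehlerC r y x); ring.
  have c1 := mehler_conv_L1 r0 r1 x x.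
  have c2 := L1Z 2 (ou_L1 r0 r1 x (L2_cst gauss 1)).
  have c3 := L1Z (2 * r * x) (ou_L1 r0 r1 x lid).
  have c4 : L1 gauss (fun y => y ^+ 2) by case: lid.
  have c5 := L1Z (2 * r * x) (L2_L1 lid).
  have c6 := L1_cst gauss (1 : R).
  have c7 := L1Z ((r * x) ^+ 2) c4.
  rewrite RintD; [|by apply: L1B => //; exact: L1B|by apply: L1D => //; exact: L1D].
  rewrite RintB//; last exact: L1B.
  rewrite RintB// RintD//; last exact: L1D.
  rewrite RintD// mehler_conv// RintZ; last exact: (ou_L1 r0 r1 x (L2_cst gauss 1)).
  rewrite RintZ; last exact: (ou_L1 r0 r1 x lid).
  rewrite RintZ; last exact: L2_L1.
  rewrite RintZ// Rint_cst gauss_mean gauss_var.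
  rewrite -/(ou r (fun=> 1) x) -/(ou r id x) ou_cst// ou_id//.
  by rewrite le_eqVlt; apply/orP; left; apply/eqP; ring.
have rN0 : 1 - r ^+ 2 != 0 by rewrite subr_eq0 gt_eqF.
have c4 : L1 gauss (fun y => y ^+ 2) by case: lid.
have c1 := mehler_trace_L1 rr0 rr1.
have c2 := L1Z (r ^+ 2) c4.
have c3 := L1_cst gauss (1 : R).
have c5 := L1B c1 c3.
apply: (@le_trans _ _ (\int[gauss]_x (F * (mehler (r ^+ 2) x x - 1 - r ^+ 2 * x ^+ 2)))).
  apply: le_Rint => //; first by case: (ou_L2 lf).
  by apply: L1Z; exact: L1B.
rewrite RintZ; last exact: L1B.
rewrite RintB// RintB// Rint_cst RintZ// gauss_var mehler_trace//.
by rewrite le_eqVlt; apply/orP; left; apply/eqP; field.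
Qed.

End param.

Lemma bernoulli_ge (q : R) n : 0 <= q -> 1 + n%:R * (q - 1) <= q ^+ n.
Proof.
move=> q0; elim: n => [|n IH]; first by rewrite mul0r addr0 expr0.
rewrite exprS -natr1; have := sqr_ge0 (q - 1); have : 0 <= n%:R :> R by [].
have := ler_wpM2l q0 IH; nra.
Qed.

(* By [ou_norm_sqr_le] the bound only has to be checked for small [r], up to a
   constant: the constant disappears when taking [2 ^ k]-th roots. *)
Lemma ou_contraction r f : 0 < r -> r < 1 -> L2 gauss f ->
  \int[gauss]_x f x = 0 -> \int[gauss]_x (x * f x) = 0 ->
  \int[gauss]_x (ou r f x ^+ 2) <= r ^+ 4 * \int[gauss]_x (f x ^+ 2).
Proof.
move=> r0 r1 lf f0 f1; set F := \int[gauss]_x (f x ^+ 2).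
pose N t := \int[gauss]_x (ou t f x ^+ 2); rewrite -/(N r).
have N0 t : 0 <= N t by apply: Rint_ge0 => x; exact: sqr_ge0.
have F0 : 0 <= F by apply: Rint_ge0 => x; exact: sqr_ge0.
have rk0 k : 0 < r ^+ (2 ^ k) by exact: exprn_gt0.
have rk1 k : r ^+ (2 ^ k) < 1 by rewrite exprn_ilt1// ?ltW// expn_eq0.
(* The inductive step of [K], which passes from a correlation [t] to [t^2] without dividing by
   powers of [F]. *)
have alg (a b c d : R) : 0 <= a -> 0 <= b -> 0 <= c -> 0 <= d ->
    F * a <= b * c -> c ^+ 2 <= F * d -> F * a ^+ 2 <= b ^+ 2 * d.
  move=> a0 b0 c0 d0 h1 h2.
  move: F0; rewrite le_eqVlt => /predU1P[F0|F0].
    by rewrite -F0 mul0r mulr_ge0// sqr_ge0.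
  rewrite -(ler_pM2l F0).
  have Fa0 : 0 <= F * a by rewrite mulr_ge0// ltW.
  have h3 : (F * a) ^+ 2 <= (b * c) ^+ 2 by rewrite lerXn2r// nnegrE mulr_ge0.
  have h4 : b ^+ 2 * c ^+ 2 <= b ^+ 2 * (F * d) by rewrite ler_wpM2l ?sqr_ge0.
  nra.
have K k : F * N r ^+ (2 ^ k) <= F ^+ (2 ^ k) * N (r ^+ (2 ^ k)).
  elim: k => [|k IH]; first by rewrite expn0 !expr1.
  have E (t : R) : t ^+ (2 ^ k.+1) = (t ^+ (2 ^ k)) ^+ 2 by rewrite expnSr exprM.
  rewrite !E; exact: (alg _ _ _ _ (exprn_ge0 _ (N0 r)) (exprn_ge0 _ F0) (N0 _)
    (N0 _) IH (ou_norm_sqr_le (rk0 k) (rk1 k) lf)).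
have r2 : 0 < 1 - r ^+ 2 by rewrite subr_gt0 expr_lt1// ltW.
(* The denominator [1 - t^2] at [t = r^(2^k)] is at least its value at [t = r], so the constant is
   uniform in [k]. *)
have H k : N (r ^+ (2 ^ k)) <= (r ^+ 4) ^+ (2 ^ k) / (1 - r ^+ 2) * F.
  apply: le_trans (ou_hilbert_schmidt (rk0 k) (rk1 k) lf f0 f1) _.
  rewrite ler_wpM2r//.
  rewrite -!exprM (mulnC 4)%N ler_wpM2l ?exprn_ge0//; first exact: ltW.
  rewrite lef_pV2 ?posrE//; last first.
    by rewrite subr_gt0 exprn_ilt1 ?ltW// muln_eq0 expn_eq0.
  rewrite lerB// ler_wiXn2l ?ltW//.
  by rewrite leq_pmull// expn_gt0.
rewrite leNgt; apply/negP => NF.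
move: F0; rewrite le_eqVlt => /predU1P[F0|F0].
  have := H 0%N; rewrite -F0 mulr0 expr1 leNgt => /negP; apply.
  by move: NF; rewrite -F0 mulr0.
have rF : 0 < r ^+ 4 * F by rewrite mulr_gt0// exprn_gt0.
(* If the claim failed, then [q > 1] while all powers [q^(2^k)] stay below one constant, against
   Bernoulli's inequality. *)
pose q := N r / (r ^+ 4 * F).
have q1 : 1 < q by rewrite ltr_pdivlMr// mul1r.
have Q k : q ^+ (2 ^ k) <= (1 - r ^+ 2)^-1.
  rewrite exprMn exprVn ler_pdivrMr ?exprn_gt0//.
  rewrite -(ler_pM2l F0); apply: (le_trans (K k)).
  apply: (@le_trans _ _ (F ^+ (2 ^ k) * ((r ^+ 4) ^+ (2 ^ k) / (1 - r ^+ 2) * F))).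
    by rewrite ler_wpM2l ?exprn_ge0// ltW.
  by rewrite le_eqVlt; apply/orP; left; apply/eqP; rewrite [in RHS]exprMn; ring.
set C := (1 - r ^+ 2)^-1 in Q.
have C0 : 0 <= C by rewrite invr_ge0 ltW.
pose n := (Num.trunc (C / (q - 1))).+1.
have := Q n; rewrite leNgt => /negP; apply.
apply: lt_le_trans (bernoulli_ge _ (ltW (lt_trans ltr01 q1))).
rewrite -subr_gt0 in q1.
have : C < (2 ^ n)%:R * (q - 1).
  rewrite -ltr_pdivrMr//.
  apply: lt_le_trans (truncnS_gt _) _.
  by rewrite ler_nat -/n; exact: ltnW (ltn_expl _ _).
by move=> h; rewrite (lt_trans h)// ltrDr.
Qed.

End contraction.

(** * The rearrangement inequality *)

Lemma measurable_ltr_set (R : realType) (d : measure_display)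
    (T : measurableType d) (f g : T -> R) :
  measurable_fun setT f -> measurable_fun setT g ->
  measurable [set x | f x < g x].
Proof.
move=> mf mg; rewrite (_ : [set _ | _] =
    setT `&` (fun x => f x < g x) @^-1` [set true]); last by rewrite setTI.
exact: (measurable_fun_ltr mf mg).
Qed.

Lemma measurable_ler_set (R : realType) (d : measure_display)
    (T : measurableType d) (f g : T -> R) :
  measurable_fun setT f -> measurable_fun setT g ->
  measurable [set x | f x <= g x].
Proof.
move=> mf mg; rewrite (_ : [set _ | _] =
    setT `&` (fun x => f x <= g x) @^-1` [set true]); last by rewrite setTI.
exact: (measurable_fun_ler mf mg).
Qed.

Section layer_cake.
Context (R : realType) (d : measure_display) (T : measurableType d)
  (P : probability T R).
Local Notation gR := (measurableTypeR R).
Local Notation mu := (@lebesgue_measure R).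

(** The constraint [0 <= a] lets the level run over the whole line: for [X >= 0], the levels whose
    slice contains [t] have Lebesgue measure [X t]. *)
Definition slice (X : T -> R) (a : R) : set T := [set t | 0 <= a < X t].

Let hypograph (X : T -> R) : set (T * gR) := [set q | 0 <= q.2 < X q.1].

Lemma measurable_hypograph (X : T -> R) : measurable_fun setT X ->
  measurable (hypograph X).
Proof.
move=> mX; rewrite (_ : hypograph X =
    [set q | 0 <= q.2] `&` [set q | q.2 < X q.1]).
  apply: measurableI; first exact: measurable_ler_set.
  apply: measurable_ltr_set; first exact: measurable_snd.
  exact: (measurableT_comp mX measurable_fst).
by apply/seteqP; split => q /=; [move/andP|move=> ?; exact/andP].
Qed.

Lemma measurable_slice (X : T -> R) a : measurable_fun setT X ->
  measurable (slice X a).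
Proof.
move=> mX; have [a0|a0] := leP 0 a.
  rewrite (_ : slice X a = [set t | a < X t]); first exact: measurable_ltr_set.
  by apply/seteqP; split => t /=; rewrite /slice/= a0.
rewrite (_ : slice X a = set0); first exact: measurable0.
by apply/seteqP; split => t //=; rewrite /slice/= leNgt a0.
Qed.

Lemma lebesgue_slice (x : R) : 0 <= x -> mu [set a : R | 0 <= a < x] = x%:E.
Proof.
move=> x0; rewrite (_ : [set a | _] = `[0, x[%classic).
  rewrite lebesgue_measure_itv/= lte_fin sube0.
  by case: ltP => // h; congr EFin; apply/eqP; rewrite eq_le h x0.
by apply/seteqP; split => a /=; rewrite in_itv.
Qed.

Lemma layer_cake_indic (E : set T) (Y : T -> R) : measurable E ->
  measurable_fun setT Y -> (forall t, 0 <= Y t) ->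
  measurable_fun setT (fun b : gR => P (E `&` slice Y b)) /\
  (\int[P]_t (\1_E t * Y t)%:E = \int[mu]_b P (E `&` slice Y b))%E.
Proof.
move=> mE mY Y0; pose A := (E `*` setT) `&` hypograph Y.
have mA : measurable A.
  by apply: measurableI; [exact: measurableX|exact: measurable_hypograph].
have HG : fubini_G P (EFin \o \1_A) = fun b => P (E `&` slice Y b).
  rewrite (indic_fubini_tonelli_GE P mA); apply/funext => b /=.
  rewrite ysectionE; congr (P _); apply/seteqP; split => t /=.
    by move=> [[? _] ?].
  by move=> [? ?].
have HF : fubini_F mu (EFin \o \1_A) = fun t => (\1_E t * Y t)%:E.
  rewrite (indic_fubini_tonelli_FE mu mA); apply/funext => t /=.
  rewrite xsectionE indicE; have [tE|tE] := boolP (t \in E).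
    rewrite mul1r -(lebesgue_slice (Y0 t)); congr (mu _).
    apply/seteqP; split => b /=; first by move=> [].
    by move=> ?; split => //; split => //; rewrite inE in tE.
  rewrite mul0r (_ : _ @^-1` A = set0) ?measure0//.
  apply/seteqP; split => b //= [[h _] _].
  by move: tE; rewrite notin_setE.
split; first by rewrite -HG; exact: indic_measurable_fun_fubini_tonelli_G.
by rewrite -HG -(indic_fubini_tonelli P mu mA) HF.
Qed.

(** Tonelli, with [X t] seen as the measure of the levels below it. Together with [layer_cake_indic]
    it gives Hoeffding's formula: [E[X Y]] is the integral of [P(X > a, Y > b)] over [a, b >= 0]. *)
Lemma layer_cakeM (X Y : T -> R) : measurable_fun setT X ->
  measurable_fun setT Y -> (forall t, 0 <= X t) -> (forall t, 0 <= Y t) ->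
  measurable_fun setT
    (fun a : gR => \int[P]_t (\1_(slice X a) t * Y t)%:E)%E /\
  (\int[P]_t (X t * Y t)%:E =
   \int[mu]_a \int[P]_t (\1_(slice X a) t * Y t)%:E)%E.
Proof.
move=> mX mY X0 Y0; have mh := measurable_hypograph mX.
pose f (q : T * gR) : \bar R := (\1_(hypograph X) q * Y q.1)%:E.
have f0 q : (0 <= f q)%E by rewrite lee_fin mulr_ge0.
have mf : measurable_fun setT f.
  apply/measurable_EFinP; apply: measurable_funM; first exact: measurable_indic.
  exact: (measurableT_comp mY measurable_fst).
have E a t : \1_(slice X a) t = \1_(hypograph X) (t, a) :> R.
  by rewrite !indicE; congr ((_ : bool)%:R); apply/idP/idP; rewrite !inE.
split; first exact: (measurable_fun_fubini_tonelli_G (m1 := P) f mf f0).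
transitivity (\int[mu]_a \int[P]_t f (t, a))%E; last first.
  by apply: eq_integral => a _; apply: eq_integral => t _; rewrite E.
rewrite -(fubini_tonelli f mf f0).
apply: eq_integral => t _.
rewrite /f/=; under eq_integral do rewrite mulrC EFinM.
rewrite ge0_integralZl//; last 2 first.
- apply/measurable_EFinP; exact: (measurableT_comp (measurable_indic mh) (measurable_pair1 t)).
- by rewrite lee_fin.
rewrite mulrC EFinM; congr (_ * _)%E.
have mI : measurable ([set a | 0 <= a < X t] : set gR).
  rewrite (_ : [set a | _] = `[0, X t[%classic); first exact: measurable_itv.
  by apply/seteqP; split => a /=; rewrite in_itv.
rewrite -[LHS](lebesgue_slice (X0 t)) -[in LHS](setIT [set a | _]).
by rewrite -(integral_indic mu measurableT mI).
Qed.

End layer_cake.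

Section rearrangement.
Context (R : realType) (d : measure_display) (T : measurableType d)
  (Q : probability T R) (G : probability (measurableTypeR R) R).
Local Notation mu := (@lebesgue_measure R).
Implicit Types (X Y : T -> R) (phi theta : R -> R).

(** Superlevel sets of nondecreasing functions on the line are upper sets, and upper sets are
    ordered by inclusion. *)
Lemma nested_superlevel_sets phi theta a b :
  {homo phi : x y / x <= y} -> {homo theta : x y / x <= y} ->
  [set t | a < phi t] `<=` [set t | b < theta t] \/
  [set t | b < theta t] `<=` [set t | a < phi t].
Proof.
move=> nphi ntheta; apply/or_asboolP; rewrite -implyNb; apply/implyP.
move=> /asboolPn; rewrite -existsNE => -[t /not_implyP[/= at_ bt]].
apply/asboolP => u /= bu; apply: lt_le_trans at_ _; apply: nphi.
by rewrite leNgt; apply/negP => /ltW/ntheta; move: bt; move/negP; rewrite -leNgt;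
  move=> h1 h2; move: bu; rewrite ltNge (le_trans h2 h1).
Qed.

(** By Hoeffding's formula it suffices to compare joint superlevel probabilities. Under [Q] they are
    at most the smaller marginal one; on the line this value is attained, because the level sets are
    nested. *)
Lemma ge0_rearrangement X Y phi theta :
  {homo phi : x y / x <= y} -> {homo theta : x y / x <= y} ->
  same_law Q G X phi -> same_law Q G Y theta ->
  (forall t, 0 <= X t) -> (forall t, 0 <= Y t) ->
  (forall t, 0 <= phi t) -> (forall t, 0 <= theta t) ->
  (\int[Q]_t (X t * Y t)%:E <= \int[G]_z (phi z * theta z)%:E)%E.
Proof.
move=> nphi ntheta Xphi Ytheta X0 Y0 phi0 theta0.
have [mX mphi lX] := Xphi; have [mY mtheta lY] := Ytheta.
have [mq ->] := layer_cakeM Q mX mY X0 Y0.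
have [mg ->] := layer_cakeM G mphi mtheta phi0 theta0.
apply: ge0_le_integral => //.
- by move=> a _; apply: integral_ge0 => t _; rewrite lee_fin mulr_ge0.
move=> a _.
have [mqb ->] := layer_cake_indic Q (measurable_slice a mX) mY Y0.
have [mgb ->] := layer_cake_indic G (measurable_slice a mphi) mtheta theta0.
apply: ge0_le_integral => // b _.
have [a0|a0] := leP 0 a; last first.
  rewrite (_ : slice X a = set0) ?set0I ?measure0//.
  by apply/seteqP; split => // t; rewrite /slice/= leNgt a0.
have [b0|b0] := leP 0 b; last first.
  rewrite (_ : slice Y b = set0) ?setI0 ?measure0//.
  by apply/seteqP; split => // t; rewrite /slice/= leNgt b0.
rewrite /slice/= a0 b0/=.
have Ea (U : Type) (f : U -> R) : [set t | a < f t] = f @^-1` `]a, +oo[%classic.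
  by apply/seteqP; split => t /=; rewrite in_itv/= andbT.
have Eb (U : Type) (f : U -> R) : [set t | b < f t] = f @^-1` `]b, +oo[%classic.
  by apply/seteqP; split => t /=; rewrite in_itv/= andbT.
have hX : Q [set t | a < X t] = G [set t | a < phi t] by rewrite !Ea lX.
have hY : Q [set t | b < Y t] = G [set t | b < theta t] by rewrite !Eb lY.
have mXa : measurable [set t | a < X t] by apply: measurable_ltr_set.
have mYb : measurable [set t | b < Y t] by apply: measurable_ltr_set.
have [h|h] := nested_superlevel_sets a b nphi ntheta.
  rewrite (setIidl h) -hX; apply: le_measure; rewrite ?inE//.
  exact: measurableI.
rewrite (setIidr h) -hY; apply: le_measure; rewrite ?inE//.
exact: measurableI.
Qed.

End rearrangement.

Section truncation.
Context (R : realType) (d : measure_display) (T : measurableType d)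
  (P : probability T R).
Implicit Types X Y : T -> R.

(** Truncating from below only preserves monotonicity, and adding [n] gives a nonnegative function;
    square integrability takes care of the upper tail. *)
Definition lower_trunc (n : nat) (x : R) : R := Num.max x (- n%:R).

Lemma measurable_lower_trunc n : measurable_fun setT (lower_trunc n).
Proof. exact: measurable_maxr. Qed.

Lemma norm_lower_trunc n x : `|lower_trunc n x| <= `|x|.
Proof.
rewrite /lower_trunc; have n0 : 0 <= n%:R :> R by [].
have [//|h] := leP (- n%:R) x.
rewrite normrN (ger0_norm n0) -normrN; apply: le_trans (ler_norm _).
by rewrite lerNr ltW.
Qed.

Lemma lower_trunc_cvg x : lower_trunc n x @[n --> \oo] --> x.
Proof.
apply: cvg_near_cst; near=> n; rewrite /lower_trunc; apply/max_idPl.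
by rewrite lerNl; near: n; exact: nbhs_infty_ger.
Unshelve. all: by end_near. Qed.

Lemma L2_lower_trunc n X : L2 P X -> L2 P (fun t => lower_trunc n (X t)).
Proof.
move=> lX; have [mX _] := lX; apply: (L2_le _ _ (L2_norm lX)).
  exact: (measurableT_comp (measurable_lower_trunc n)).
by move=> t; exact: norm_lower_trunc.
Qed.

Lemma Rint_lower_trunc_cvg X Y : L2 P X -> L2 P Y ->
  \int[P]_t (lower_trunc n (X t) * lower_trunc n (Y t)) @[n --> \oo] -->
  \int[P]_t (X t * Y t).
Proof.
move=> lX lY; apply: fine_cvg; rewrite -(RintE (L2_L1M lX lY)).
apply: (@dominated_cvg _ _ _ P setT measurableT _ _
  (fun t => (`|X t| * `|Y t|)%:E)) => //.
- move=> n; apply/measurable_EFinP; apply: L1_measurable.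
  by apply: L2_L1M; exact: L2_lower_trunc.
- move=> t _; apply: cvg_EFin; first exact: nearW.
  by apply: cvgM; exact: lower_trunc_cvg.
- exact: (L2_L1M (L2_norm lX) (L2_norm lY)).
- move=> n t _; rewrite lee_fin normrM.
  by apply: ler_pM => //; exact: norm_lower_trunc.
Qed.

End truncation.

Lemma rearrangement (R : realType) (d : measure_display) (T : measurableType d)
    (Q : probability T R) (G : probability (measurableTypeR R) R)
    (X Y : T -> R) (phi theta : R -> R) :
  {homo phi : x y / x <= y} -> {homo theta : x y / x <= y} ->
  same_law Q G X phi -> same_law Q G Y theta ->
  L2 G phi -> L2 G theta ->
  \int[Q]_t (X t * Y t) <= \int[G]_z (phi z * theta z).
Proof.
move=> nphi ntheta lawX lawY lphi ltheta.
have lX : L2 Q X by exact: (same_law_L2 lawX (@measurable_id _ R setT)).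
have lY : L2 Q Y by exact: (same_law_L2 lawY (@measurable_id _ R setT)).
apply: (ler_cvg_to (Rint_lower_trunc_cvg lX lY)
  (Rint_lower_trunc_cvg lphi ltheta)); apply: nearW => n.
pose s (x : R) := lower_trunc n x + n%:R.
have ms : measurable_fun setT s.
  by apply: measurable_funD => //; exact: measurable_lower_trunc.
have s0 x : 0 <= s x by rewrite -lerBlDr sub0r le_max lexx orbT.
have ns : {homo s : x y / x <= y}.
  by move=> x y xy; rewrite lerD2r /lower_trunc ge_max !le_max xy lexx orbT.
have lawsX := same_law_comp ms lawX; have lawsY := same_law_comp ms lawY.
have := @ge0_rearrangement R d T Q G (s \o X) (s \o Y) (s \o phi) (s \o theta)
  (fun x y xy => ns _ _ (nphi _ _ xy)) (fun x y xy => ns _ _ (ntheta _ _ xy))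
  lawsX lawsY (fun t => s0 _) (fun t => s0 _) (fun t => s0 _) (fun t => s0 _).
(* Besides the truncated product, the expansion only has terms in the separate laws; these agree on
   both sides and cancel. *)
have E d' (T' : measurableType d') (P : probability T' R) (f g : T' -> R) :
    L2 P f -> L2 P g ->
    (\int[P]_t (s (f t) * s (g t))%:E)%E =
    (\int[P]_t (lower_trunc n (f t) * lower_trunc n (g t)) +
     (n%:R * \int[P]_t lower_trunc n (f t) +
      n%:R * \int[P]_t lower_trunc n (g t) + n%:R ^+ 2))%:E.
  move=> lf lg; have lf' := L2_lower_trunc n lf; have lg' := L2_lower_trunc n lg.
  have c1 := L2_cst P (n%:R : R).
  rewrite RintE; last by apply: L2_L1M; exact: L2D.
  have l1 := L1Z n%:R (L2_L1 lf'); have l2 := L1Z n%:R (L2_L1 lg').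
  congr EFin; transitivity (\int[P]_t (lower_trunc n (f t) * lower_trunc n (g t) +
      (n%:R * lower_trunc n (f t) + n%:R * lower_trunc n (g t) + n%:R ^+ 2))).
    by apply: eq_Rint => t; rewrite /s; ring.
  rewrite RintD; [|exact: L2_L1M|by apply: L1D; [exact: L1D|exact: L1_cst]].
  rewrite RintD; [|exact: L1D|exact: L1_cst].
  by rewrite RintD// Rint_cst RintZ ?RintZ//; exact: L2_L1.
rewrite /= !E// lee_fin.
rewrite -(same_law_Rint lawX (measurable_lower_trunc n)).
rewrite -(same_law_Rint lawY (measurable_lower_trunc n)).
by rewrite lerD2r.
Qed.

(** * Couplings *)

Section product_laws.
Context (R : realType) (d1 d2 : measure_display) (T1 : measurableType d1)
  (T2 : measurableType d2) (P : probability T1 R) (Q : probability T2 R).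

Lemma same_law_fst : same_law (P \x Q)%E P fst id.
Proof.
split; [exact: measurable_fst|exact: measurable_id|move=> A mA].
rewrite (_ : fst @^-1` A = A `*` setT).
  have := product_measure1E P Q mA measurableT.
  by rewrite [X in (_ * X)%E](_ : _ = 1%E) ?mule1//; exact: probability_setT.
by apply/seteqP; split => t //= [].
Qed.

Lemma same_law_snd : same_law (P \x Q)%E Q snd id.
Proof.
split; [exact: measurable_snd|exact: measurable_id|move=> A mA].
rewrite (_ : snd @^-1` A = setT `*` A).
  have := product_measure1E P Q measurableT mA.
  by rewrite [X in (X * _)%E](_ : _ = 1%E) ?mul1e//; exact: probability_setT.
by apply/seteqP; split => t //= [].
Qed.

Lemma L2_fst (f : T1 -> R) : L2 P f -> L2 (P \x Q)%E (fun t => f t.1).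
Proof. by move=> lf; have [mf _] := lf; exact: (same_law_L2 same_law_fst mf). Qed.

Lemma L2_snd (f : T2 -> R) : L2 Q f -> L2 (P \x Q)%E (fun t => f t.2).
Proof. by move=> lf; have [mf _] := lf; exact: (same_law_L2 same_law_snd mf). Qed.

Lemma Rint_fst (f : T1 -> R) : measurable_fun setT f ->
  \int[(P \x Q)%E]_t f t.1 = \int[P]_t f t.
Proof. exact: (same_law_Rint same_law_fst). Qed.

Lemma Rint_snd (f : T2 -> R) : measurable_fun setT f ->
  \int[(P \x Q)%E]_t f t.2 = \int[Q]_t f t.
Proof. exact: (same_law_Rint same_law_snd). Qed.

Lemma Rint_fstMsnd (f : T1 -> R) (g : T2 -> R) : L2 P f -> L2 Q g ->
  \int[(P \x Q)%E]_t (f t.1 * g t.2) = \int[P]_t f t * \int[Q]_t g t.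
Proof.
move=> lf lg; rewrite Rint_prod1; last 2 first.
- by apply: L2_L1M; [exact: L2_fst|exact: L2_snd].
- by move=> x /=; apply: L1Z; exact: L2_L1.
transitivity (\int[P]_t ((\int[Q]_t g t) * f t)).
  by apply: eq_Rint => t /=; rewrite RintZ 1?mulrC//; exact: L2_L1.
by rewrite RintZ 1?mulrC//; exact: L2_L1.
Qed.

End product_laws.

(** * Normalized sums of two independent standard normal variables *)

Section gauss_convolution.
Context (R : realType) (d : measure_display) (T : measurableType d)
  (P : probability T R) (y : T -> R).
Hypothesis lawy : same_law P (gauss R) y id.
Local Notation gauss := (gauss R).

Definition isqrt2 : R := (Num.sqrt 2)^-1.
Local Notation k := isqrt2.

Lemma isqrt2_gt0 : 0 < k. Proof. by rewrite invr_gt0 sqrtr_gt0. Qed.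

Lemma isqrt2_sqr : k ^+ 2 = 2^-1.
Proof. by rewrite exprVn sqr_sqrtr. Qed.

Lemma isqrt2_lt1 : k < 1.
Proof.
by rewrite -(@ltr_pXn2r _ 2)// ?nnegrE ?(ltW isqrt2_gt0)// isqrt2_sqr expr1n invf_lt1// ltr1n.
Qed.

(** At this correlation [r x + sqrt (1 - r^2) z] is [k (x + z)], so averaging over one of the two
    copies is the operator [ou k]. *)
Lemma isqrt2_compl : Num.sqrt (1 - k ^+ 2) = k.
Proof.
rewrite (_ : 1 - k ^+ 2 = k ^+ 2); first by rewrite sqrtr_sqr gtr0_norm// isqrt2_gt0.
by rewrite isqrt2_sqr; field.
Qed.

Let my : measurable_fun setT y. Proof. by case: lawy. Qed.

Let w (t : T * T) : R := k * (y t.1 + y t.2).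

Let mw : measurable_fun setT w.
Proof.
rewrite /w; apply: measurable_funM => //; apply: measurable_funD.
  exact: (measurableT_comp my measurable_fst).
exact: (measurableT_comp my measurable_snd).
Qed.

Lemma gauss_sum_L1 (f : R -> R) u : L2 gauss f ->
  L1 P (fun t => f (k * (u + y t))).
Proof.
move=> lf; have [mf _] := lf.
pose h (z : R) := f (k * u + k * z).
have mh : measurable_fun setT h.
  have ma : measurable_fun setT (fun z : R => k * u + k * z).
    by apply: measurable_funD => //; exact: measurable_funM.
  exact: (measurableT_comp mf ma).
have : L1 gauss h.
  have := mehler_law_L1 isqrt2_gt0 isqrt2_lt1 u lf.
  by rewrite isqrt2_compl.
move=> /(same_law_L1 lawy mh); apply: eq_L1 => t.
by rewrite /h/= -mulrDr.
Qed.

Lemma gauss_sum_ou (f : R -> R) u : L2 gauss f ->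
  \int[P]_t f (k * (u + y t)) = ou k f u.
Proof.
move=> lf; have [mf _] := lf.
pose h (z : R) := f (k * u + k * z).
have mh : measurable_fun setT h.
  have ma : measurable_fun setT (fun z : R => k * u + k * z).
    by apply: measurable_funD => //; exact: measurable_funM.
  exact: (measurableT_comp mf ma).
rewrite (ouE isqrt2_gt0 isqrt2_lt1)// isqrt2_compl.
rewrite -[RHS](same_law_Rint lawy mh).
by apply: eq_Rint => t; rewrite /h mulrDr.
Qed.

(** Tested on indicators: integrating out one copy gives [ou k] of the indicator, which has the
    integral of the indicator itself since [ou k] is self-adjoint and fixes constants. *)
Lemma gauss_sum_law : same_law (P \x P)%E gauss w id.
Proof.
split => // A mA.
have mI : measurable_fun setT (\1_A : R -> R) by exact: measurable_indic.
have lI : L2 gauss (\1_A).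
  apply: (L2_le _ _ (L2_cst gauss 1)) => // x.
  by rewrite ger0_norm// indicE lern1; case: (_ \in _).
have mIw : measurable_fun setT (fun t => \1_A (w t) : R).
  exact: (measurableT_comp mI mw).
have lw : L1 (P \x P)%E (fun t => \1_A (w t)).
  apply: (L1_le mIw _ (L1_cst (P \x P)%E 1)) => t.
  by rewrite ger0_norm// indicE lern1; case: (_ \in _).
have E1 : \int[(P \x P)%E]_t \1_A (w t) = fine ((P \x P)%E (w @^-1` A)).
  rewrite /Rintegral -(setIT (w @^-1` A)) -integral_indic//.
  by rewrite -[X in measurable X]setTI; exact: mw.
have E2 : \int[gauss]_t \1_A t = fine (gauss A).
  by rewrite /Rintegral integral_indic// setIT.
have E : \int[(P \x P)%E]_t \1_A (w t) = \int[gauss]_t \1_A t.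
  rewrite (Rint_prod1 lw) => [|t]; last exact: (gauss_sum_L1 (y t) lI).
  transitivity (\int[P]_t ou k (\1_A) (y t)).
    by apply: eq_Rint => t; rewrite /w/= gauss_sum_ou.
  have lo := ou_L2 isqrt2_gt0 isqrt2_lt1 lI; have [mo _] := lo.
  rewrite (same_law_Rint lawy mo).
  transitivity (\int[gauss]_x (1 * ou k (\1_A) x)).
    by apply: eq_Rint => x; rewrite mul1r.
  rewrite (ou_selfadjoint isqrt2_gt0 isqrt2_lt1 lI (L2_cst gauss 1)).
  by apply: eq_Rint => x; rewrite (ou_cst isqrt2_gt0 isqrt2_lt1) mul1r.
have mwA : measurable (w @^-1` A) by rewrite -[X in measurable X]setTI; exact: mw.
rewrite -[LHS]fineK ?fin_num_measure//.
rewrite -[RHS]fineK; last by rewrite fin_num_measure.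
by rewrite -E1 E E2.
Qed.

End gauss_convolution.

(** * The cost estimate for a standardized coupling *)

Section coupling.
Context (R : realType) (d : measure_display) (T : measurableType d)
  (P : probability T R).
Variables (x y : T -> R) (phi : R -> R) (c : R).
Local Notation gauss := (gauss R).
Local Notation k := (isqrt2 R).
Hypotheses (lawy : same_law P gauss y id) (lx : L2 P x).
Hypotheses (x_mean : \int[P]_t x t = 0) (x_var : \int[P]_t (x t ^+ 2) = 1).
Local Notation P2 := (P \x P)%E.
Let s (t : T * T) : R := k * (x t.1 + x t.2).
Let w (t : T * T) : R := k * (y t.1 + y t.2).
Hypotheses (laws : same_law P2 gauss s phi) (phi_nd : {homo phi : u v / u <= v}).

Let k0 : 0 < k := isqrt2_gt0 R.
Let k1 : k < 1 := isqrt2_lt1 R.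
Let my : measurable_fun setT y. Proof. by case: lawy. Qed.
Let mphi : measurable_fun setT phi. Proof. by case: laws. Qed.
Let lid : L2 gauss id := gauss_id_L2 R.
Let ly : L2 P y. Proof. exact: (same_law_L2 lawy (@measurable_id _ R setT)). Qed.
Let y_var : \int[P]_t (y t ^+ 2) = 1.
Proof.
have m2 : measurable_fun setT (fun z : R => z ^+ 2) by exact: measurable_funX.
by rewrite (same_law_Rint lawy m2) gauss_var.
Qed.

Let ls : L2 P2 s. Proof. by apply: L2Z; apply: L2D; [exact: L2_fst|exact: L2_snd]. Qed.
Let lphi : L2 gauss phi.
Proof. exact: (same_law_L2 (same_law_sym laws) (@measurable_id _ R setT)). Qed.

(** [a] and [b] are the covariances of the given coupling and of the monotone coupling [(phi Z, Z)];
    [m] is the mixed term that links them. *)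
Let a := \int[P]_t (x t * y t).
Let b := \int[gauss]_z (z * phi z).
Let m := \int[P2]_t (s t * phi (w t)).

Let phi_mean : \int[gauss]_z phi z = 0.
Proof.
rewrite -(same_law_Rint laws (@measurable_id _ R setT)) RintZ; last first.
  by apply: L2_L1; apply: L2D; [exact: L2_fst|exact: L2_snd].
rewrite RintD; [|exact: (L2_L1 (L2_fst _ lx))|exact: (L2_L1 (L2_snd _ lx))].
have [mx _] := lx.
by rewrite Rint_fst// Rint_snd// x_mean addr0 mulr0.
Qed.

(** The cross terms factor by independence and vanish because [x] is centred. Used with [z = y] for
    the covariance of [(s, w)] and with [z = x] for the variance of [s]. *)
Let sum_pairing (z : T -> R) : L2 P z ->
  \int[P2]_t (s t * (k * (z t.1 + z t.2))) = \int[P]_t (x t * z t).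
Proof.
move=> lz; have [mx _] := lx; have [mz _] := lz.
have lx1 : L2 P2 (fun t => x t.1) := L2_fst _ lx.
have lx2 : L2 P2 (fun t => x t.2) := L2_snd _ lx.
have lz1 : L2 P2 (fun t => z t.1) := L2_fst _ lz.
have lz2 : L2 P2 (fun t => z t.2) := L2_snd _ lz.
have mxz : measurable_fun setT (fun t => x t * z t) by exact: measurable_funM.
transitivity (\int[P2]_t (2^-1 * ((x t.1 * z t.1 + x t.1 * z t.2) +
                                  (z t.1 * x t.2 + x t.2 * z t.2)))).
  by apply: eq_Rint => t; rewrite -isqrt2_sqr /s; ring.
have l11 := L2_L1M lx1 lz1; have l12 := L2_L1M lx1 lz2.
have l21 := L2_L1M lz1 lx2; have l22 := L2_L1M lx2 lz2.
rewrite RintZ; last by apply: L1D; exact: L1D.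
rewrite RintD; [|exact: L1D|exact: L1D].
rewrite !RintD// (Rint_fst _ _ mxz) (Rint_snd _ _ mxz) Rint_fstMsnd// Rint_fstMsnd//.
by rewrite x_mean mul0r mulr0; field.
Qed.

Let phi_var : \int[gauss]_z (phi z ^+ 2) = 1.
Proof.
have m2 : measurable_fun setT (fun z : R => z ^+ 2) by exact: measurable_funX.
rewrite -(same_law_Rint laws m2) -x_var.
transitivity (\int[P2]_t (s t * (k * (x t.1 + x t.2)))).
  by apply: eq_Rint => t; rewrite expr2.
by rewrite sum_pairing//; apply: eq_Rint => t; rewrite expr2.
Qed.

Let laww : same_law P2 gauss w id. Proof. exact: gauss_sum_law. Qed.

Let lphiw : L2 P2 (fun t => phi (w t)).
Proof. exact: (same_law_L2 laww mphi). Qed.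

(** Each half of [s] involves one copy of [x]; integrating out the other copy turns [phi (w)] into
    [ou k phi], and both halves contribute equally. *)
Let sphiw : m = 2 * k * \int[P]_t (x t * ou k phi (y t)).
Proof.
have lx1 : L2 P2 (fun t => x t.1) := L2_fst _ lx.
have lx2 : L2 P2 (fun t => x t.2) := L2_snd _ lx.
have l1 := L2_L1M lx1 lphiw; have l2 := L2_L1M lx2 lphiw.
rewrite /m; transitivity (\int[P2]_t (k * (x t.1 * phi (w t) + x t.2 * phi (w t)))).
  by apply: eq_Rint => t; rewrite /s; ring.
rewrite RintZ; last exact: L1D.
rewrite RintD//.
have -> : \int[P2]_t (x t.1 * phi (w t)) = \int[P]_t (x t * ou k phi (y t)).
  rewrite (Rint_prod1 l1) => [|t]; last first.
    exact: (L1Z (x t) (gauss_sum_L1 lawy (y t) lphi)).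
  apply: eq_Rint => t; rewrite -(gauss_sum_ou lawy (y t) lphi) -RintZ//.
  exact: gauss_sum_L1.
have -> : \int[P2]_t (x t.2 * phi (w t)) = \int[P]_t (x t * ou k phi (y t)).
  have E (t u : T) : x t * phi (k * (y t + y u)) = x t * phi (w (u, t)).
    by rewrite /w/= addrC.
  rewrite (Rint_prod2 l2) => [|t]; last first.
    exact: (eq_L1 (E t) (L1Z (x t) (gauss_sum_L1 lawy (y t) lphi))).
  apply: eq_Rint => t; rewrite -(gauss_sum_ou lawy (y t) lphi) -RintZ//.
    by apply: eq_Rint => u; rewrite E.
  exact: gauss_sum_L1.
by ring.
Qed.

(** This is the part of [phi] orthogonal to the affine functions, as [phi] is centred and [b] is its
    coefficient along the identity. *)
Let l2 : L2 gauss (fun z => phi z - b * z).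
Proof. by apply: L2B => //; exact: L2Z. Qed.

Let ou_phiE z : ou k phi z = b * (k * z) + ou k (fun z => phi z - b * z) z.
Proof.
rewrite -(ou_id k0 k1) /ou -RintZ; last exact: ou_L1.
rewrite -RintD; [|by apply: L1Z; exact: ou_L1|exact: ou_L1].
by apply: eq_Rint => u; ring.
Qed.

Let e2 := \int[gauss]_z (ou k (fun z => phi z - b * z) z ^+ 2).

Let lo2 : L2 gauss (ou k (fun z => phi z - b * z)).
Proof. exact: ou_L2. Qed.

Let lo2y : L2 P (fun t => ou k (fun z => phi z - b * z) (y t)).
Proof. by have [mo _] := lo2; exact: (same_law_L2 lawy mo). Qed.

Let l2_mean : \int[gauss]_z (phi z - b * z) = 0.
Proof.
rewrite RintB; [|exact: L2_L1|by apply: L1Z; exact: L2_L1].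
by rewrite RintZ ?gauss_mean ?phi_mean ?mulr0 ?subr0//; exact: L2_L1.
Qed.

Let l2_id : \int[gauss]_z (z * (phi z - b * z)) = 0.
Proof.
have l1 := L2_L1M lid lphi; have [_ l3] := lid.
transitivity (\int[gauss]_z (z * phi z - b * z ^+ 2)).
  by apply: eq_Rint => z; ring.
by rewrite RintB ?RintZ ?gauss_var ?mulr1 ?subrr//; exact: L1Z.
Qed.

Let l2_var : \int[gauss]_z ((phi z - b * z) ^+ 2) = 1 - b ^+ 2.
Proof.
have l1 := L2_L1M lid lphi; have [_ l3] := lid; have [_ l4] := lphi.
transitivity (\int[gauss]_z ((phi z ^+ 2 - (2 * b) * (z * phi z)) + b ^+ 2 * z ^+ 2)).
  by apply: eq_Rint => z; ring.
rewrite RintD; [|by apply: L1B => //; exact: L1Z|exact: L1Z].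
rewrite RintB; [|by []|exact: L1Z].
by rewrite !RintZ// phi_var gauss_var -/b; ring.
Qed.

Let e2_le : 4 * e2 <= 1 - b ^+ 2.
Proof.
have := ou_contraction k0 k1 l2 l2_mean l2_id; rewrite l2_var -/e2.
by rewrite (_ : k ^+ 4 = 4^-1) => [|]; [lra|rewrite (exprM k 2 2) isqrt2_sqr; field].
Qed.

(** Lets [x] be replaced by its residual [x - a y], of squared norm [1 - a^2], in the pairing with
    the orthogonal part. *)
Let y_ou : \int[P]_t (y t * ou k (fun z => phi z - b * z) (y t)) = 0.
Proof.
have [mo _] := lo2.
have mf : measurable_fun setT (fun z : R => z * ou k (fun z => phi z - b * z) z).
  exact: measurable_funM.
rewrite (same_law_Rint lawy mf) /=.
rewrite (ou_selfadjoint k0 k1 l2 lid).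
transitivity (\int[gauss]_z (k * (z * (phi z - b * z)))).
  by apply: eq_Rint => z; rewrite (ou_id k0 k1); ring.
by rewrite RintZ ?l2_id ?mulr0//; exact: L2_L1M.
Qed.

(** The affine part of [phi] contributes [2 a b] to [2 m], the rest at most
    [(1 - a^2) / 2 + (1 - b^2)]; then [2 a b - b^2 <= a^2] removes [b]. As [s] and [phi (w)] have
    norm one, this is the lower bound on [E(s - phi(w))^2]. *)
Let m_le : 2 * m <= 3 / 2 + a ^+ 2 / 2.
Proof.
have [_ x2] := lx; have [_ y2] := ly; have lxy := L2_L1M lx ly.
have lxo := L2_L1M lx lo2y; have lyo := L2_L1M ly lo2y.
pose o t := ou k (fun z => phi z - b * z) (y t).
have lxay : L2 P (fun t => x t - a * y t) by apply: L2B => //; exact: L2Z.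
have E1 : \int[P]_t (x t * ou k phi (y t)) =
    k * b * a + \int[P]_t ((x t - a * y t) * o t).
  transitivity (\int[P]_t (k * b * (x t * y t) + x t * o t)).
    by apply: eq_Rint => t; rewrite ou_phiE /o; ring.
  rewrite RintD//; last exact: L1Z.
  rewrite RintZ//; congr (_ + _).
  transitivity (\int[P]_t (x t * o t - a * (y t * o t))); last first.
    by apply: eq_Rint => t; ring.
  by rewrite RintB//; [rewrite RintZ// y_ou mulr0 subr0|exact: L1Z].
have E2 : \int[P]_t ((x t - a * y t) ^+ 2) = 1 - a ^+ 2.
  transitivity (\int[P]_t ((x t ^+ 2 - (2 * a) * (x t * y t)) + a ^+ 2 * y t ^+ 2)).
    by apply: eq_Rint => t; ring.
  rewrite RintD; [|by apply: L1B => //; exact: L1Z|exact: L1Z].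
  rewrite RintB; [|by []|exact: L1Z].
  by rewrite !RintZ// x_var y_var -/a; ring.
have E3 : \int[P]_t (o t ^+ 2) = e2.
  have [mo _] := lo2.
  have mf : measurable_fun setT (fun z : R => ou k (fun z => phi z - b * z) z ^+ 2).
    exact: measurable_funX.
  exact: (same_law_Rint lawy mf).
have I : 4 * k * \int[P]_t ((x t - a * y t) * o t) <= 2^-1 * (1 - a ^+ 2) + 4 * e2.
  have [_ l3] := lxay; have [_ l4] := lo2y.
  rewrite -E2 -E3 -!RintZ//; last exact: L2_L1M.
  rewrite -RintD; [|exact: L1Z|exact: L1Z].
  apply: le_Rint => [||t]; first by apply: L1Z; exact: L2_L1M.
    by apply: L1D; exact: L1Z.
  (* Young's inequality; the weight [4 k] produces the term [4 * e2], the quantity bounded by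
     [e2_le]. *)
  have := sqr_ge0 ((x t - a * y t) - 4 * k * o t); have := isqrt2_sqr R.
  nra.
rewrite sphiw E1; have k2 := isqrt2_sqr R.
have -> : 2 * (2 * k * (k * b * a + \int[P]_t ((x t - a * y t) * o t))) =
  4 * k ^+ 2 * (a * b) + 4 * k * \int[P]_t ((x t - a * y t) * o t) by ring.
rewrite k2; have := e2_le; have := sqr_ge0 (a - b); nra.
Qed.

Hypotheses (c_gt0 : 0 < c) (theta_nd : {homo (fun z => z - c * phi z) : u v / u <= v}).

Lemma coupling_cost_le :
  \int[gauss]_z ((phi z - z) ^+ 2) <= 2 - 2 * a - c * (1 - a ^+ 2) / 2.
Proof.
have [_ l3] := lid; have [_ l4] := lphi; have l5 := L2_L1M lid lphi.
have -> : \int[gauss]_z ((phi z - z) ^+ 2) = 2 - 2 * b.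
  transitivity (\int[gauss]_z ((phi z ^+ 2 - 2 * (z * phi z)) + z ^+ 2)).
    by apply: eq_Rint => z; ring.
  rewrite RintD//; last by apply: L1B => //; exact: L1Z.
  by rewrite RintB ?RintZ ?phi_var ?gauss_var -/b//; [ring|exact: L1Z].
pose theta z := z - c * phi z.
have ltheta : L2 gauss theta by apply: L2B => //; exact: L2Z.
have [mtheta _] := ltheta.
have lawt : same_law P2 gauss (theta \o w) theta by exact: (same_law_comp mtheta laww).
have := rearrangement phi_nd theta_nd laws lawt lphi ltheta.
have lw : L2 P2 w by exact: (same_law_L2 laww (@measurable_id _ R setT)).
have lsw := L2_L1M ls lw; have lsp := L2_L1M ls lphiw.
have -> : \int[P2]_t (s t * (theta \o w) t) = a - c * m.
  transitivity (\int[P2]_t (s t * w t - c * (s t * phi (w t)))).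
    by apply: eq_Rint => t; rewrite /theta/=; ring.
  by rewrite RintB ?RintZ ?sum_pairing//; exact: L1Z.
have -> : \int[gauss]_z (phi z * theta z) = b - c.
  transitivity (\int[gauss]_z (z * phi z - c * (phi z ^+ 2))).
    by apply: eq_Rint => z; rewrite /theta; ring.
  by rewrite RintB ?RintZ ?phi_var ?mulr1//; exact: L1Z.
(* [h] says [b >= a + c (1 - m)], and [m_le] gives [1 - m >= (1 - a^2) / 4]. *)
move=> h; have := ler_wpM2l (ltW c_gt0) m_le; nra.
Qed.

End coupling.

(** * The quantile map *)

Lemma cdfE (R : realType) (d : measure_display) (T : measurableType d)
    (P : probability T R) (X : {RV P >-> R}) x : cdf X x = (fine (cdf X x))%:E.
Proof. by rewrite fineK// fin_num_measure. Qed.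

Section continuous_cdf.
Context (R : realType) (d : measure_display) (T : measurableType d)
  (P : probability T R) (X : {RV P >-> R}).
Hypothesis atomless : forall x, P (X @^-1` [set x]) = 0%E.

Let fcdf (x : R) : R := fine (cdf X x).

Lemma measurable_RV (Y : {RV P >-> R}) A : measurable A -> measurable (Y @^-1` A).
Proof.
by move=> mA; rewrite -[X in measurable X]setTI; exact: measurable_funP.
Qed.

Lemma fcdf_nd x y : x <= y -> fine (cdf X x) <= fine (cdf X y).
Proof. by move=> xy; rewrite -lee_fin -!cdfE cdf_nondecreasing. Qed.

Let fcdf_right : right_continuous fcdf.
Proof.
move=> x; apply: fine_cvg; rewrite -cdfE; exact: cdf_right_continuous.
Qed.

(* Left continuity at [x] is right continuity of the distribution function of
   [- X] at [- x], as [P (X = x) = 0]. *)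
Lemma continuous_fcdf : continuous (fun x => fine (cdf X x)).
Proof.
move=> x; apply/left_right_continuousP; split; last exact: fcdf_right.
have mN : measurable_fun setT (fun t => - X t).
  by apply: measurableT_comp => //; exact: measurable_funP.
pose Y : {RV P >-> R} := mfun_Sub (mem_set mN).
have E z : cdf X z = (1 - fine (cdf Y (- z)))%:E.
  have mz : measurable (X @^-1` `]z, +oo[%classic) by exact: measurable_RV.
  have m1 : measurable (X @^-1` [set z]) by exact: measurable_RV.
  have -> : cdf Y (- z) = P (X @^-1` `]z, +oo[%classic).
    rewrite /cdf /distribution /pushforward.
    rewrite (_ : Y @^-1` _ = X @^-1` `]z, +oo[%classic `|` X @^-1` [set z]).
      rewrite measureU//.
        exact: (etrans (congr1 (adde _) (atomless z)) (adde0 _)).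
      apply/seteqP; split => t //= [] /[swap] ->.
      by rewrite in_itv/= ltxx.
    apply/seteqP; split => t /=; rewrite !in_itv/= lerN2 andbT le_eqVlt.
      by move=> /predU1P[->|?]; [right|left].
    by move=> [->|->]; rewrite ?eqxx ?orbT.
  rewrite EFinB fineK ?fin_num_measure//.
  rewrite -(probability_setC P mz); congr (P _).
  by rewrite preimage_setC setCitvr.
have h : fine (cdf Y y) @[y --> (- x)^'+] --> fine (cdf Y (- x)).
  by apply: fine_cvg; rewrite -cdfE; exact: cdf_right_continuous.
have h' : fine (cdf Y (- z)) @[z --> x^'-] --> fine (cdf Y (- x)).
  apply/cvg_at_leftNP; rewrite (_ : _ \o _ = fun y => fine (cdf Y y))//.
  by apply/funext => z; rewrite /comp opprK.
suff : 1 - fine (cdf Y (- z)) @[z --> x^'-] --> 1 - fine (cdf Y (- x)).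
  rewrite (E x) (_ : (fun z => fine (cdf X z)) = fun z => 1 - fine (cdf Y (- z)))//.
  by apply/funext => z; rewrite E.
by apply: cvgB => //; exact: cvg_cst.
Qed.

Lemma fcdf_surj p : 0 < p < 1 -> exists u, fine (cdf X u) = p.
Proof.
move=> /andP[p0 p1].
have h0 : fcdf u @[u --> -oo] --> (0 : R) by apply: fine_cvg; exact: cvg_cdfNy0.
have h1 : fcdf u @[u --> +oo] --> (1 : R) by apply: fine_cvg; exact: cvg_cdfy1.
have [a ap] := filter_ex (cvgr_lt _ h0 _ p0).
have [b pb] := filter_ex (cvgr_gt _ h1 _ p1).
have ab : a <= b.
  by rewrite leNgt; apply/negP => /ltW/fcdf_nd; rewrite leNgt (lt_trans ap pb).
have [|//|u _ <-] := @IVT R fcdf a b p ab.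
- by apply: continuous_subspaceT; exact: continuous_fcdf.
- by rewrite ge_min le_max (ltW ap) (ltW pb) orbT.
by exists u.
Qed.

End continuous_cdf.

Section normal_cdf_theory.
Context (R : realType).
Variables (m s : R).
Hypothesis s0 : 0 < s.
Let sN0 : s != 0. Proof. by rewrite gt_eqF. Qed.
Local Notation N := (normal_prob m s).

Lemma measurable_idR :
  @measurable_fun _ _ (measurableTypeR R) R setT (fun x => x).
Proof. exact: measurable_id. Qed.

Definition normal_id : {RV N >-> R} :=
  @mfun_Sub _ _ (measurableTypeR R) R _ (mem_set measurable_idR).

Lemma normal_cdfE x : normal_cdf m (s ^+ 2) x = cdf normal_id x.
Proof. by rewrite /normal_cdf sqrf_eq0 (negbTE sN0) sqrtr_sqr gtr0_norm. Qed.

Lemma normal_atomless x : N (normal_id @^-1` [set x]) = 0%E.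
Proof.
have /null_content_dominatesP := normal_prob_dominates m s; apply.
  exact: measurable_set1.
exact: lebesgue_measure_set1.
Qed.

Lemma normal_itv_gt0 x y : x < y -> (0 < N `]x, y]%classic)%E.
Proof.
(* Between [x] and [y], [(z - m)^2] is at most the larger endpoint value, hence at most [M]; so [e]
   bounds the density from below. *)
move=> xy; pose M := (x - m) ^+ 2 + (y - m) ^+ 2.
pose e := normal_peak s * expR (- M / (s ^+ 2 *+ 2)).
have e0 : 0 < e by rewrite mulr_gt0 ?expR_gt0// normal_peak_gt0.
apply: (@lt_le_trans _ _ (\int[lebesgue_measure]_(z in `]x, y]%classic) e%:E)%E).
  rewrite integral_cst//= lebesgue_measure_itv/= lte_fin xy -EFinD -EFinM lte_fin.
  by rewrite mulr_gt0// subr_gt0.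
apply: ge0_le_integral => //.
- by move=> z _; rewrite lee_fin ltW.
- by apply/measurable_EFinP/measurable_funTS; exact: measurable_normal_pdf.
move=> z /=; rewrite in_itv/= => /andP[xz zy].
rewrite lee_fin normal_pdfE// ler_wpM2l ?normal_peak_ge0// ler_expR.
rewrite ler_wpM2r ?invr_ge0 ?mulrn_wge0 ?sqr_ge0// lerN2 /M.
have := sqr_ge0 (x - m); have := sqr_ge0 (y - m).
have [mz|zm] := leP m z.
  have := mulr_ge0 (_ : 0 <= y - z) (_ : 0 <= (y - m) + (z - m)); nra.
have := mulr_ge0 (_ : 0 <= z - x) (_ : 0 <= (m - x) + (m - z)); nra.
Qed.

Lemma normal_cdf_lt x y : x < y -> (cdf normal_id x < cdf normal_id y)%E.
Proof.
move=> xy; rewrite /cdf /distribution /pushforward.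
rewrite (_ : normal_id @^-1` `]-oo, y] = `]-oo, x]%classic `|` `]x, y]%classic).
  rewrite measureU//; last first.
    apply/seteqP; split => z //= []; rewrite !in_itv/= => zx /andP[].
    by rewrite ltNge zx.
  rewrite lteDl ?normal_itv_gt0//.
  by apply: fin_num_measure; exact: measurable_itv.
apply/seteqP; split => z /=; rewrite !in_itv/=.
  by move=> ->; rewrite andbT; have [|] := leP z x; [left|right].
by move=> [zx|/andP[]//]; rewrite (le_trans zx)// ltW.
Qed.

Lemma normal_cdf_gt0 x : (0 < cdf normal_id x)%E.
Proof.
apply: le_lt_trans (normal_cdf_lt (_ : x - 1 < x)); first exact: cdf_ge0.
by rewrite gtrBl.
Qed.

Lemma normal_cdf_lt1 x : (cdf normal_id x < 1)%E.
Proof.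
apply: lt_le_trans (normal_cdf_lt (_ : x < x + 1)) _; last exact: cdf_le1.
by rewrite ltrDl.
Qed.

Lemma normal_cdf_le x y : (cdf normal_id x <= cdf normal_id y)%E = (x <= y).
Proof.
apply/idP/idP; last exact: cdf_nondecreasing.
by apply: contraTT; rewrite -!ltNge; exact: normal_cdf_lt.
Qed.

Lemma normal_cdf_inj : injective (cdf normal_id).
Proof.
move=> x y E; apply/eqP; rewrite eq_le -!normal_cdf_le E lexx//.
Qed.

Lemma normal_cdf_invK x : normal_cdf_inv m (s ^+ 2) (cdf normal_id x) = x.
Proof.
have E : normal_cdf m (s ^+ 2) = cdf normal_id.
  by apply/funext => z; exact: normal_cdfE.
rewrite /normal_cdf_inv E; apply: pinvKV; last by rewrite inE.
by move=> u v _ _; exact: normal_cdf_inj.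
Qed.

Lemma normal_cdf_surj p : (0 < p < 1)%E -> exists w, cdf normal_id w = p.
Proof.
case: p => [p| |]; rewrite ?lte_fin//=; last by rewrite andbF.
move=> p01; have [w <-] := fcdf_surj normal_atomless p01.
by exists w; rewrite -cdfE.
Qed.

End normal_cdf_theory.

Section quantile.
Context (R : realType) (d : measure_display) (T : measurableType d)
  (P : probability T R) (S : {RV P >-> R}).
Variables (m s c : R).
Hypotheses (s0 : 0 < s) (c0 : 0 < c).
Hypothesis atomless : forall x, P (S @^-1` [set x]) = 0%E.
Local Notation N := (normal_prob m s).
Local Notation Ncdf := (cdf (normal_id m s)).
Let g : R -> R := normal_cdf_inv m (s ^+ 2) \o cdf S.
Hypothesis dg : forall u, (0 < cdf S u < 1)%E -> derivable g u 1 /\ c <= derive1 g u.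

Let gK u : (0 < cdf S u < 1)%E -> Ncdf (g u) = cdf S u.
Proof. by move=> /(normal_cdf_surj m s)[w E]; rewrite /g/= -E normal_cdf_invK. Qed.

Let I_itv u v z : (0 < cdf S u < 1)%E -> (0 < cdf S v < 1)%E -> u <= z -> z <= v ->
  (0 < cdf S z < 1)%E.
Proof.
move=> /andP[u0 _] /andP[_ v1] uz zv; apply/andP; split.
  exact: lt_le_trans u0 (cdf_nondecreasing _ uz).
exact: le_lt_trans (cdf_nondecreasing _ zv) v1.
Qed.

(** The set where [0 < cdf S < 1] is an interval, so [g - c id] has a nonnegative derivative on all
    of [[u, v]]. *)
Let g_incr u v : (0 < cdf S u < 1)%E -> (0 < cdf S v < 1)%E -> u <= v ->
  g u - c * u <= g v - c * v.
Proof.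
move=> Iu Iv uv; pose f : R -> R := g - (c \*: (@id R)).
have df z : z \in `[u, v] -> derivable f z 1.
  rewrite in_itv/= => /andP[uz zv].
  have [dgz _] := dg (I_itv Iu Iv uz zv).
  exact: derivableB.
apply: (@ger0_derive1_le_cc _ f u v) => //.
- by move=> z /subset_itv_oo_cc; exact: df.
- move=> z /subset_itv_oo_cc zuv; move: (zuv); rewrite in_itv/= => /andP[uz zv].
  have [dgz cg] := dg (I_itv Iu Iv uz zv).
  rewrite derive1E deriveB//.
  by rewrite deriveZ// derive_id -derive1E /GRing.scale/= mulr1 subr_ge0.
- by apply: derivable_within_continuous.
- by rewrite in_itv/= lexx.
- by rewrite in_itv/= uv lexx.
Qed.

(** [phi w] is any point where [cdf S] takes the normal value at [w]; it exists because [cdf S] is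
    continuous, and [g (phi w) = w]. Hence [z - c phi z] is [g - c id] evaluated along the
    nondecreasing [phi]. *)
Lemma quantile_map : exists phi : R -> R,
  [/\ {homo phi : u v / u <= v}, {homo (fun z => z - c * phi z) : u v / u <= v} &
      same_law N P phi S].
Proof.
have /choice[phi Hphi] : forall w, exists u, cdf S u = Ncdf w.
  move=> w; have := normal_cdf_gt0 m s0 w; have := normal_cdf_lt1 m s0 w.
  rewrite cdfE !lte_fin => w1 w0.
  have [|u E] := @fcdf_surj _ _ _ _ S atomless (fine (Ncdf w)); first by rewrite w0.
  by exists u; rewrite [LHS]cdfE E.
have I w : (0 < cdf S (phi w) < 1)%E.
  by rewrite Hphi normal_cdf_gt0 ?normal_cdf_lt1.
have gphi w : g (phi w) = w by rewrite /g/= Hphi normal_cdf_invK.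
have nphi : {homo phi : u v / u <= v}.
  move=> u v uv; rewrite leNgt; apply/negP => h.
  have := cdf_nondecreasing S (ltW h); rewrite !Hphi normal_cdf_le// => vu.
  by move: h; rewrite (_ : u = v) ?ltxx//; apply/eqP; rewrite eq_le uv.
exists phi; split => //.
  by move=> u v uv; rewrite -{1}(gphi u) -{1}(gphi v); apply: g_incr => //; exact: nphi.
have mphi : measurable_fun setT phi by exact: nondecreasing_measurable.
apply: same_law_cdf => // u.
have E (U : Type) (f : U -> R) : [set t | f t <= u] = f @^-1` `]-oo, u]%classic.
  by apply/seteqP; split => t /=; rewrite in_itv.
transitivity (cdf S u); last by rewrite [in RHS]E.
(* Outside the domain of [g], [phi w <= u] holds for no [w] or for all [w], as the normal
   distribution function stays strictly between 0 and 1. *)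
have [F0|F0] := eqVneq (cdf S u) 0%E.
  rewrite F0 (_ : [set t | _] = set0) ?measure0//.
  apply/seteqP; split => // w /= /(cdf_nondecreasing S).
  by rewrite F0 Hphi leNgt normal_cdf_gt0.
have [F1|F1] := eqVneq (cdf S u) 1%E.
  rewrite F1 (_ : [set t | _] = setT) ?probability_setT//.
  apply/seteqP; split => // w _ /=; rewrite leNgt; apply/negP => /ltW.
  by move=> /(cdf_nondecreasing S); rewrite F1 Hphi leNgt normal_cdf_lt1.
have Iu : (0 < cdf S u < 1)%E.
  by rewrite lt_neqAle eq_sym F0 cdf_ge0/= lt_neqAle F1 cdf_le1.
rewrite -(gK Iu) (_ : [set t | _] = normal_id m s @^-1` `]-oo, g u]%classic)//.
apply/seteqP; split => w /=; rewrite in_itv/=.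
  by move=> /(cdf_nondecreasing S); rewrite Hphi -(gK Iu) normal_cdf_le.
(* If [u < phi w], then [g u <= w - c (phi w - u) < w], against [w <= g u]. *)
move=> wu; rewrite leNgt; apply/negP => h.
have := g_incr Iu (I w) (ltW h); rewrite gphi.
by rewrite -subr_gt0 in h; have := mulr_gt0 c0 h; lra.
Qed.

End quantile.

(** * Sums, moments and transport costs *)

Section laws.
Context (R : realType).

Lemma same_law_eq_cdf (d1 d2 : measure_display) (T1 : measurableType d1)
    (T2 : measurableType d2) (P : probability T1 R) (Q : probability T2 R)
    (X : {RV P >-> R}) (Y : {RV Q >-> R}) :
  same_law P Q X Y <-> cdf X = cdf Y.
Proof.
split=> [[_ _ XY]|XY].
  by apply/funext => x; apply: XY; exact: measurable_itv.
apply: same_law_cdf => [||x]; [exact: measurable_funP|exact: measurable_funP|].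
have E (U : Type) (f : U -> R) : [set t | f t <= x] = f @^-1` `]-oo, x]%classic.
  by apply/seteqP; split => t /=; rewrite in_itv.
by rewrite (E _ X) (E _ Y); exact: (congr1 (@^~ x) XY).
Qed.

Lemma same_law_normal_cdf (d : measure_display) (T : measurableType d)
    (P : probability T R) (X : {RV P >-> R}) m s : 0 < s ->
  same_law P (normal_prob m s) X (fun x => x) <-> cdf X = normal_cdf m (s ^+ 2).
Proof.
move=> s0; have -> : normal_cdf m (s ^+ 2) = cdf (normal_id m s).
  by apply/funext => x; exact: normal_cdfE.
exact: (same_law_eq_cdf X (normal_id m s)).
Qed.

Lemma joint_law (d : measure_display) (T : measurableType d)
    (M : probability T R) (X Y : T -> R) (D1 D2 : probability R R) :
  measurable_fun setT X -> measurable_fun setT Y ->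
  (forall A B, measurable A -> measurable B ->
    M (X @^-1` A `&` Y @^-1` B) = (D1 A * D2 B)%E) ->
  same_law M (D1 \x D2)%E (fun t => (X t, Y t)) id.
Proof.
move=> mX mY XY; have mXY := measurable_fun_pair mX mY.
split => // A mA.
pose Z : {mfun T >-> (R * R)%type} := mfun_Sub (mem_set mXY).
by rewrite preimage_id; exact: esym (@product_measure_unique _ _ _ _ _ D1 D2 (distribution M Z) XY _ mA).
Qed.

Lemma indep_joint_law (d : measure_display) (T : measurableType d)
    (P : probability T R) (X Y : {RV P >-> R}) :
  independent_RV X Y -> identically_distributed X Y ->
  same_law P (distribution P X \x distribution P X)%E
    (fun t => (X t, Y t)) id.
Proof.
move=> iXY dXY; apply: joint_law => [||A B mA mB]; [exact: measurable_funP..|].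
by rewrite iXY// [X in (_ * X)%E](_ : _ = distribution P Y B)// -dXY.
Qed.

(** With [indep_joint_law], this transfers the law of the pair [(X1, X2)] to two independent copies
    on the square of any space that carries a coupling. *)
Lemma prod_joint_law (d d' : measure_display) (T : measurableType d)
    (T' : measurableType d') (P : probability T R) (Q : probability T' R)
    (X : {RV P >-> R}) (Y : T' -> R) :
  same_law Q P Y X ->
  same_law (Q \x Q)%E (distribution P X \x distribution P X)%E
    (fun t => (Y t.1, Y t.2)) id.
Proof.
move=> [mY _ YX]; apply: joint_law => [||A B mA mB].
- exact: (measurableT_comp mY measurable_fst).
- exact: (measurableT_comp mY measurable_snd).
have mYm C : measurable C -> measurable (Y @^-1` C).
  by move=> mC; rewrite -[X in measurable X]setTI; exact: mY.
exact: (etrans (product_measure1E Q Q (mYm _ mA) (mYm _ mB))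
  (congr2 mule (YX _ mA) (YX _ mB))).
Qed.

(** For each value of the first variable, exactly one value of the second gives the sum [u], and a
    law with density does not charge points; Fubini concludes. *)
Lemma sum_atomless (d : measure_display) (T : measurableType d)
    (P : probability T R) (X Y : {RV P >-> R}) u :
  independent_RV X Y -> identically_distributed X Y -> has_density X ->
  P (normalized_sum X Y @^-1` [set u]) = 0%E.
Proof.
move=> iXY dXY [f [mf f0 Xf]]; have [_ _ H] := indep_joint_law iXY dXY.
pose C : set (R * R) := (fun p => (p.1 + p.2) * (Num.sqrt 2)^-1) @^-1` [set u].
have mC : measurable C.
  rewrite -[X in measurable X]setTI.
  have mh : measurable_fun setT (fun p : R * R => (p.1 + p.2) * (Num.sqrt 2)^-1).
    apply: measurable_funM => //; apply: measurable_funD.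
      exact: measurable_fst.
    exact: measurable_snd.
  exact: mh.
apply: (etrans (H C mC)); rewrite preimage_id /product_measure1.
apply: integral0_eq => x _ /=.
rewrite (_ : xsection C x = [set u * Num.sqrt 2 - x]).
  by rewrite Xf//; exact: integral_set1.
have s0 : Num.sqrt 2 != 0 :> R by rewrite gt_eqF// sqrtr_gt0.
rewrite xsectionE; apply/seteqP; split => y /=; rewrite /C/=.
  by move=> <-; rewrite mulfVK// addrC addKr.
by move=> ->; rewrite addrC subrK mulfK.
Qed.

End laws.

Section moments.
Context (R : realType).

Lemma Lfun2_L2 (d : measure_display) (T : measurableType d)
    (P : probability T R) (X : T -> R) : X \in Lfun P 2%:E -> L2 P X.
Proof.
move=> lX; split; last exact: Lfun2_integrable_sqr.
by move: lX; rewrite inE => /andP[]; rewrite inE.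
Qed.

Lemma L2_Lfun2 (d : measure_display) (T : measurableType d)
    (P : probability T R) (X : T -> R) : L2 P X -> X \in Lfun P 2%:E.
Proof.
move=> [mX lX]; rewrite inE; apply/andP; split; rewrite inE//=.
rewrite /finite_norm unlock poweR_lty//.
rewrite [X in (X < _)%E](_ : _ = \int[P]_t (X t ^+ 2)%:E)%E; last first.
  apply: eq_integral => t _ /=.
  by rewrite -[2%:R]/(2%:R) powR_mulrn// real_normK// num_real.
by rewrite RintE// ltry.
Qed.

Lemma expectationE (d : measure_display) (T : measurableType d)
    (P : probability T R) (X : T -> R) : L1 P X ->
  'E_P[X]%E = (\int[P]_t X t)%:E.
Proof. by move=> lX; rewrite unlock RintE. Qed.

Lemma variance_Rint (d : measure_display) (T : measurableType d)
    (P : probability T R) (X : T -> R) : L2 P X ->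
  'V_P[X]%E = (\int[P]_t (X t ^+ 2) - (\int[P]_t X t) ^+ 2)%:E.
Proof.
move=> lX; have [_ lX2] := lX; rewrite varianceE; last exact: L2_Lfun2.
rewrite (expectationE (L2_L1 lX)) (_ : X ^+ 2 = fun t => X t ^+ 2).
  by rewrite (expectationE lX2) EFinB EFin_expe.
by apply/funext => t; rewrite /= !expr2.
Qed.

End moments.

Section d2_couplings.
Context (R : realType).
Implicit Types F G : R -> \bar R.

Lemma d2_sqrE F G : (d2 F G ^+ 2)%E = ereal_inf [set c : \bar R |
  exists (d : measure_display) (T : measurableType d) (P : probability T R)
         (X Y : {RV P >-> R}),
    [/\ cdf X = F, cdf Y = G & c = 'E_P[fun t => (`|X t - Y t| ^+ 2)%R]%E]].
Proof.
rewrite /d2 sqr_sqrte//; apply: le_ereal_inf_tmp => _ [d [T [P [X [Y [_ _ ->]]]]]].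
by apply: expectation_ge0 => t; exact: exprn_ge0.
Qed.

Lemma d2_sqr_ge0 F G : (0 <= d2 F G ^+ 2)%E.
Proof.
rewrite d2_sqrE; apply: le_ereal_inf_tmp => _ [d [T [P [X [Y [_ _ ->]]]]]].
by apply: expectation_ge0 => t; exact: exprn_ge0.
Qed.

Lemma d2_sqr_le F G (d : measure_display) (T : measurableType d)
    (P : probability T R) (X Y : {RV P >-> R}) :
  cdf X = F -> cdf Y = G -> L2 P X -> L2 P Y ->
  (d2 F G ^+ 2 <= (\int[P]_t ((X t - Y t) ^+ 2))%:E)%E.
Proof.
move=> XF YG lX lY; rewrite d2_sqrE; apply: ereal_inf_lbound.
exists d, T, P, X, Y; split => //; have [_ lXY] := L2B lX lY.
rewrite -(expectationE lXY); congr expectation.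
by apply/funext => t; rewrite real_normK// num_real.
Qed.

End d2_couplings.

Lemma isqrt2_double (R : realType) : isqrt2 R * 2 = Num.sqrt 2.
Proof.
have s2 : Num.sqrt 2 ^+ 2 = 2 :> R by rewrite sqr_sqrtr.
by rewrite -[X in _ * X]s2 /isqrt2 expr2 mulKf// gt_eqF// sqrtr_gt0.
Qed.

Section standardization.
Context (R : realType) (d : measure_display) (T : measurableType d)
  (P : probability T R).

Lemma standardized_moments (X : T -> R) m s : 0 < s -> L2 P X ->
  \int[P]_t X t = m -> \int[P]_t (X t ^+ 2) = s ^+ 2 + m ^+ 2 ->
  [/\ L2 P (fun t => s^-1 * (X t - m)), \int[P]_t (s^-1 * (X t - m)) = 0 &
      \int[P]_t ((s^-1 * (X t - m)) ^+ 2) = 1].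
Proof.
move=> s0 lX X1 X2; have sN0 : s != 0 by rewrite gt_eqF.
have c1 := L2_cst P m; have lXm : L2 P (fun t => X t - m) by exact: L2B.
have [_ lX2] := lX; have l1 := L2_L1 lX.
split; first exact: L2Z.
  by rewrite RintZ ?RintB ?Rint_cst ?X1 ?subrr ?mulr0//; [exact: L1_cst|exact: L2_L1].
transitivity (\int[P]_t (s^-1 ^+ 2 * ((X t ^+ 2 - (2 * m) * X t) + m ^+ 2))).
  by apply: eq_Rint => t; ring.
have l3 := L1Z (2 * m) l1; have l4 := L1_cst P (m ^+ 2).
rewrite RintZ; last by apply: L1D => //; exact: L1B.
rewrite RintD//; last exact: L1B.
by rewrite RintB// RintZ// Rint_cst X1 X2; field.
Qed.

End standardization.

Section normalized_sum_theory.
Context (R : realType) (d : measure_display) (T : measurableType d)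
  (P : probability T R) (X1 X2 : {RV P >-> R}).
Hypotheses (X12_indep : independent_RV X1 X2)
  (X12_id : identically_distributed X1 X2).
Local Notation S := (normalized_sum X1 X2).
Local Notation k := (isqrt2 R).

(** [Y] will be [X1] itself for the moments, and the first component of a coupling for the cost
    estimate. *)
Lemma normalized_sum_law (d' : measure_display) (T' : measurableType d')
    (Q : probability T' R) (Y : T' -> R) : same_law Q P Y X1 ->
  same_law P (Q \x Q)%E S (fun t => k * (Y t.1 + Y t.2)).
Proof.
move=> YX; have J := same_law_trans (indep_joint_law X12_indep X12_id)
  (same_law_sym (prod_joint_law YX)).
have mf : measurable_fun setT (fun p : R * R => (p.1 + p.2) * (Num.sqrt 2)^-1).
  apply: measurable_funM => //; apply: measurable_funD.
    exact: measurable_fst.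
  exact: measurable_snd.
have := same_law_comp mf J.
by rewrite (_ : _ \o (fun t : T' * T' => _) = fun t => k * (Y t.1 + Y t.2))//;
  apply/funext => t /=; rewrite mulrC.
Qed.

Lemma normalized_sum_moments m s : L2 P X1 -> \int[P]_t X1 t = m ->
  \int[P]_t (X1 t ^+ 2) = s ^+ 2 + m ^+ 2 ->
  [/\ L2 P S, \int[P]_t S t = Num.sqrt 2 * m &
      \int[P]_t (S t ^+ 2) = s ^+ 2 + (Num.sqrt 2 * m) ^+ 2].
Proof.
move=> l1 E1 E2.
have X11 : same_law P P X1 X1 by split => //; exact: measurable_funP.
have lawS := normalized_sum_law X11.
have lf : L2 (P \x P)%E (fun t => X1 t.1) := L2_fst _ l1.
have ls : L2 (P \x P)%E (fun t => X1 t.2) := L2_snd _ l1.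
have lsum : L2 (P \x P)%E (fun t => k * (X1 t.1 + X1 t.2)).
  by apply: L2Z; exact: L2D.
have mX : measurable_fun setT X1 by exact: measurable_funP.
have mX2 : measurable_fun setT (fun t => X1 t ^+ 2) by exact: measurable_funX.
have m2 : measurable_fun setT (fun z : R => z ^+ 2) by exact: measurable_funX.
have s2 : Num.sqrt 2 ^+ 2 = 2 :> R by rewrite sqr_sqrtr.
have sN0 : Num.sqrt 2 != 0 :> R by rewrite gt_eqF// sqrtr_gt0.
split.
- exact: (same_law_L2 lawS (@measurable_id _ R setT)).
- rewrite (same_law_Rint lawS (@measurable_id _ R setT)) RintZ; last exact: L2_L1 (L2D _ _).
  rewrite RintD; [|exact: L2_L1|exact: L2_L1].
  rewrite (Rint_fst _ _ mX) (Rint_snd _ _ mX) E1 -isqrt2_double.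
  by ring.
- rewrite (same_law_Rint lawS m2).
  transitivity (\int[(P \x P)%E]_t (2^-1 * ((X1 t.1 ^+ 2 + 2 * (X1 t.1 * X1 t.2)) + X1 t.2 ^+ 2))).
    by apply: eq_Rint => t; rewrite -(isqrt2_sqr R); ring.
  have [_ lf2] := lf; have [_ ls2] := ls; have lfs := L2_L1M lf ls.
  have l2 := L1Z 2 lfs.
  rewrite RintZ; last by apply: L1D => //; exact: L1D.
  rewrite RintD//; last exact: L1D.
  rewrite RintD// RintZ// (Rint_fst _ _ mX2) (Rint_snd _ _ mX2) Rint_fstMsnd//.
  by rewrite E1 E2 exprMn s2; field.
Qed.

End normalized_sum_theory.

(** * From standardized couplings to the bound on the distance *)

Section main.
Context (R : realType) (d : measure_display)
    (T : measurableType d) (P : probability T R) (X1 X2 : {RV P >-> R})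
    (mu sigma c : R)
    (X12_indep : independent_RV X1 X2)
    (X12_id : identically_distributed X1 X2)
    (X1_L2 : L2 P X1) (X1_mean : \int[P]_t X1 t = mu)
    (X1_sqr : \int[P]_t (X1 t ^+ 2) = sigma ^+ 2 + mu ^+ 2)
    (sigma_gt0 : 0 < sigma)
    (X1_density : has_density X1)
    (c_gt0 : 0 < c).
Local Notation S := (normalized_sum X1 X2).
Let g : R -> R := normal_cdf_inv mu (sigma ^+ 2) \o cdf S.
Hypothesis dg : forall u : R, (0 < cdf S u < 1)%E -> derivable g u 1 /\ c <= derive1 g u.
Local Notation k := (isqrt2 R).
Local Notation sqrt2 := (Num.sqrt (2 : R)).

Let std (m u : R) : R := sigma^-1 * (u - m).
Let mstd m : measurable_fun setT (std m).
Proof. by rewrite /std; apply: measurable_funM => //; exact: measurable_funB. Qed.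
Let unstd (m u : R) : R := m + sigma * u.
Let munstd m : measurable_fun setT (unstd m).
Proof. by rewrite /unstd; apply: measurable_funD => //; exact: measurable_funM. Qed.
Let sN0 : sigma != 0. Proof. by rewrite gt_eqF. Qed.
Let unstdK m : cancel (unstd m) (std m).
Proof. by move=> u; rewrite /std /unstd; field. Qed.
Let stdK m : cancel (std m) (unstd m).
Proof. by move=> u; rewrite /std /unstd; field. Qed.
Let k2 : k * 2 = sqrt2. Proof. exact: isqrt2_double. Qed.

Let std_normal m : same_law (normal_prob m sigma) (gauss R) (std m) id.
Proof.
have := same_law_comp (mstd m) (normal_prob_affine m sigma_gt0).
have -> : std m \o (fun z : R => m + sigma * z) = id.
  by apply/funext => z; exact: unstdK.
by [].
Qed.

Lemma normalized_sum_d2_le (d' : measure_display) (T' : measurableType d')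
    (Q : probability T' R) (X Y : {RV Q >-> R}) :
  cdf X = cdf X1 -> cdf Y = normal_cdf mu (sigma ^+ 2) ->
  (d2 (cdf S) (normal_cdf (sqrt2 * mu) (sigma ^+ 2)) ^+ 2 <=
   ((1 - c / 2) * (\int[Q]_t ((X t - Y t) ^+ 2)) +
    c / (8 * sigma ^+ 2) * (\int[Q]_t ((X t - Y t) ^+ 2)) ^+ 2)%:E)%E.
Proof.
move=> cdfX cdfY; set D := \int[Q]_t ((X t - Y t) ^+ 2).
have lawX : same_law Q P X X1 by apply/same_law_eq_cdf.
have lawY : same_law Q (normal_prob mu sigma) Y (fun x => x).
  exact/same_law_normal_cdf.
have [lx0 x_mean x_var] := standardized_moments sigma_gt0 X1_L2 X1_mean X1_sqr.
pose x t := std mu (X t); pose y t := std mu (Y t).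
have lx : L2 Q x by exact: (same_law_L2 lawX (mstd mu)).
have xm : \int[Q]_t x t = 0 by rewrite (same_law_Rint lawX (mstd mu)).
have xv : \int[Q]_t (x t ^+ 2) = 1.
  have m2 : measurable_fun setT (fun z => std mu z ^+ 2) by exact: measurable_funX.
  by rewrite (same_law_Rint lawX m2).
have lawy : same_law Q (gauss R) y id.
  exact: (same_law_trans (same_law_comp (mstd mu) lawY) (std_normal mu)).
have atomless u : P (S @^-1` [set u]) = 0%E by exact: sum_atomless.
have [phi [phi_nd theta_nd lawphi]] := quantile_map sigma_gt0 c_gt0 atomless dg.
(* Argument and value use different means: [g] refers to [N(mu, sigma^2)], while [S] has mean
   [sqrt 2 mu]. In [z - c psi z] this only adds a constant. *)
pose psi z := std (sqrt2 * mu) (phi (unstd mu z)).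
have mphi : measurable_fun setT phi by exact: nondecreasing_measurable.
have mphiu : measurable_fun setT (fun z => phi (unstd mu z)).
  exact: (measurableT_comp mphi (munstd mu)).
have lawphiu : same_law (gauss R) P (fun z : R => phi (unstd mu z)) S.
  apply: same_law_trans lawphi; apply: same_law_sym.
  exact: (same_law_comp mphi (normal_prob_affine mu sigma_gt0)).
have lawpsi : same_law (Q \x Q)%E (gauss R) (fun t => k * (x t.1 + x t.2)) psi.
  apply: same_law_sym; apply: (same_law_trans (same_law_comp (mstd (sqrt2 * mu)) lawphiu)).
  have := same_law_comp (mstd (sqrt2 * mu)) (normalized_sum_law X12_indep X12_id lawX).
  rewrite (_ : _ \o (fun t : T' * T' => _) = fun t => k * (x t.1 + x t.2))//.
  by apply/funext => t /=; rewrite /x /std -k2; ring.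
have psi_nd : {homo psi : u v / u <= v}.
  move=> u v uv; rewrite /psi /std ler_pM2l ?invr_gt0// lerD2r; apply: phi_nd.
  by rewrite /unstd lerD2l ler_pM2l.
have psi_theta : {homo (fun z => z - c * psi z) : u v / u <= v}.
  move=> u v uv; have uv' : unstd mu u <= unstd mu v.
    by rewrite /unstd lerD2l ler_pM2l.
  have th := theta_nd _ _ uv'; rewrite -(ler_pM2l sigma_gt0).
  have E z : sigma * (z - c * psi z) =
      unstd mu z - c * phi (unstd mu z) - (mu - c * (sqrt2 * mu)).
    by rewrite /psi /std /unstd; field.
  by rewrite /= !E lerD2r; exact: th.
have := coupling_cost_le lawy lx xm xv lawpsi psi_nd c_gt0 psi_theta.
set a := \int[Q]_t (x t * y t) => cost.
have ly : L2 Q y by exact: (same_law_L2 lawy (@measurable_id _ R setT) (gauss_id_L2 R)).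
have yv : \int[Q]_t (y t ^+ 2) = 1.
  have m2 : measurable_fun setT (fun z : R => z ^+ 2) by exact: measurable_funX.
  by rewrite (same_law_Rint lawy m2) gauss_var.
have DE : D = sigma ^+ 2 * (2 - 2 * a).
  have [_ x2] := lx; have [_ y2] := ly; have lxy := L1Z 2 (L2_L1M lx ly).
  transitivity (\int[Q]_t (sigma ^+ 2 * ((x t ^+ 2 - 2 * (x t * y t)) + y t ^+ 2))).
    by apply: eq_Rint => t; rewrite /x /y /std; field.
  rewrite RintZ; last by apply: L1D => //; exact: L1B.
  rewrite RintD//; last exact: L1B.
  by rewrite RintB// RintZ ?xv ?yv -/a; [ring|exact: L2_L1M].
(* The improved coupling lives on the line: [phi] of a normal variable, and that variable recentred
   at [sqrt 2 mu]. *)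
pose X' : {RV (gauss R) >-> R} := @mfun_Sub _ _ (measurableTypeR R) R _ (mem_set mphiu).
have mY' : measurable_fun setT (unstd (sqrt2 * mu) : measurableTypeR R -> R) by exact: munstd.
pose Y' : {RV (gauss R) >-> R} := @mfun_Sub _ _ (measurableTypeR R) R _ (mem_set mY').
have X'S : cdf X' = cdf S by exact/same_law_eq_cdf.
have Y'N : cdf Y' = normal_cdf (sqrt2 * mu) (sigma ^+ 2).
  apply/same_law_normal_cdf => //; apply: same_law_sym.
  exact: (normal_prob_affine (sqrt2 * mu) sigma_gt0).
have lpsi : L2 (gauss R) psi.
  apply: (same_law_L2 (same_law_sym lawpsi) (@measurable_id _ R setT)).
  by apply: L2Z; apply: L2D; [exact: L2_fst|exact: L2_snd].
have lY' : L2 (gauss R) Y'.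
  by apply: L2D; [exact: L2_cst|apply: L2Z; exact: gauss_id_L2].
have lX' : L2 (gauss R) X'.
  apply: (eq_L2 _ (L2D (L2_cst (gauss R) (sqrt2 * mu)) (L2Z sigma lpsi))) => z.
  exact: (stdK (sqrt2 * mu)).
apply: (le_trans (d2_sqr_le X'S Y'N lX' lY')); rewrite lee_fin.
have -> : \int[gauss R]_z ((X' z - Y' z) ^+ 2) =
    sigma ^+ 2 * \int[gauss R]_z ((psi z - z) ^+ 2).
  rewrite -RintZ.
    apply: eq_Rint => z; rewrite -{1}(stdK (sqrt2 * mu) (X' z)).
    rewrite -[std _ _]/(psi z) /Y'/= /unstd; ring.
  by have [] := L2B lpsi (gauss_id_L2 R).
rewrite -(ler_pM2l (_ : 0 < sigma ^+ 2)) in cost; last exact: exprn_gt0.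
(* By [DE], [1 - a = D / (2 sigma^2)] and [1 + a = 2 - D / (2 sigma^2)], so the gain
   [c sigma^2 (1 - a^2) / 2] is [c D / 2 - c D^2 / (8 sigma^2)]. *)
apply: (le_trans cost); rewrite le_eqVlt; apply/orP; left; apply/eqP.
by rewrite DE; field.
Qed.

End main.

(* The independent coupling has cost [2 s ^ 2]. *)
Lemma normal_sqdist_le (R : realType) (d : measure_display)
    (T : measurableType d) (P : probability T R) (X : {RV P >-> R}) (m s : R) :
  0 < s -> L2 P X -> \int[P]_t X t = m ->
  \int[P]_t (X t ^+ 2) = s ^+ 2 + m ^+ 2 ->
  (d2 (cdf X) (normal_cdf m (s ^+ 2)) ^+ 2 <= (2 * s ^+ 2)%:E)%E.
Proof.
move=> s0 lX X1 X2; have sN0 : s != 0 by rewrite gt_eqF.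
have [lx xm xv] := standardized_moments s0 lX X1 X2.
have lid := gauss_id_L2 R; have mX : measurable_fun setT X by exact: measurable_funP.
pose Q := (P \x gauss R)%E.
have lawX : same_law Q P (fun t => X t.1) X.
  exact: (same_law_comp mX (same_law_fst P (gauss R))).
have maff : measurable_fun setT (fun z : R => m + s * z).
  by apply: measurable_funD => //; exact: measurable_funM.
have lawY : same_law Q (normal_prob m s) (fun t => m + s * t.2) (fun z => z).
  apply: (same_law_trans (same_law_comp maff (same_law_snd P (gauss R)))).
  exact: (same_law_sym (normal_prob_affine m s0)).
have [mX' _ _] := lawX; have [mY' _ _] := lawY.
pose X' : {RV Q >-> R} := mfun_Sub (mem_set mX').
pose Y' : {RV Q >-> R} := mfun_Sub (mem_set mY').
have cX : cdf X' = cdf X by exact/same_law_eq_cdf.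
have cY : cdf Y' = normal_cdf m (s ^+ 2) by exact/same_law_normal_cdf.
have lX' : L2 Q X' by exact: L2_fst.
have lY' : L2 Q Y'.
  apply: L2D; [exact: L2_cst|apply: L2Z].
  exact: (L2_snd P lid).
apply: (le_trans (d2_sqr_le cX cY lX' lY')); rewrite lee_fin.
have lx1 := L2_fst (gauss R) lx; have lz := L2_snd P lid.
have [_ lx2] := lx1; have [_ lz2] := lz; have lxz := L1Z 2 (L2_L1M lx1 lz).
have mx2 : measurable_fun setT (fun t => (s^-1 * (X t - m)) ^+ 2).
  by have [mx _] := lx; exact: measurable_funX.
have mz2 : @measurable_fun _ _ (measurableTypeR R) R setT (fun z => z ^+ 2).
  exact: measurable_funX.
rewrite (_ : \int[Q]_t _ = \int[Q]_t (s ^+ 2 *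
    (((s^-1 * (X t.1 - m)) ^+ 2 - 2 * ((s^-1 * (X t.1 - m)) * t.2)) + t.2 ^+ 2))); last first.
  by apply: eq_Rint => t; rewrite /X' /Y' /=; field.
rewrite RintZ; last by apply: L1D => //; exact: L1B.
rewrite RintD//; last exact: L1B.
rewrite RintB// RintZ; last exact: (L2_L1M lx1 lz).
rewrite (Rint_fst _ _ mx2) (Rint_snd _ _ mz2) (Rint_fstMsnd lx lid) xv xm.
by rewrite gauss_var; lra.
Qed.

Theorem proposition4p1 (R : realType) (d : measure_display)
    (T : measurableType d) (P : probability T R) (X1 X2 : {RV P >-> R})
    (mu sigma c : R)
    (X12_indep : independent_RV X1 X2)
    (X12_id : identically_distributed X1 X2)
    (X1_L2 : (X1 : T -> R) \in Lfun P 2%:E)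
    (X1_mean : 'E_P[X1]%E = mu%:E)
    (X1_var : 'V_P[X1]%E = (sigma ^+ 2)%:E)
    (sigma_gt0 : 0 < sigma)
    (X1_density : has_density X1) (X2_density : has_density X2)
    (c_gt0 : 0 < c) :
  let S := normalized_sum X1 X2 in
  let D := @normal_sqdist R d T P in
  let g : R -> R := normal_cdf_inv mu (sigma ^+ 2) \o cdf S in
  (forall u : R, (0 < cdf S u < 1)%E -> derivable g u 1 /\ c <= derive1 g u) ->
  (D S <= (1 - c / 2)%:E * D X1 + (c / (8 * sigma ^+ 2))%:E * D X1 ^+ 2)%E
  /\
  ((1 - c / 2)%:E * D X1 + (c / (8 * sigma ^+ 2))%:E * D X1 ^+ 2
    <= (1 - c / 4)%:E * D X1)%E.
Proof.
move=> S D g dg.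
have lX := Lfun2_L2 X1_L2.
have Em : \int[P]_t X1 t = mu.
  by apply: EFin_inj; rewrite -(expectationE (L2_L1 lX)).
have Es : \int[P]_t (X1 t ^+ 2) = sigma ^+ 2 + mu ^+ 2.
  have := congr1 fine (etrans (esym (variance_Rint lX)) X1_var).
  by rewrite /= Em; lra.
have [lS ESm ESs] := normalized_sum_moments X12_indep X12_id lX Em Es.
have DX : D X1 = (d2 (cdf X1) (normal_cdf mu (sigma ^+ 2)) ^+ 2)%E.
  by rewrite /D /normal_sqdist X1_mean X1_var.
have DS : D S = (d2 (cdf S) (normal_cdf (Num.sqrt 2 * mu) (sigma ^+ 2)) ^+ 2)%E.
  have VS : 'V_P[S]%E = (sigma ^+ 2)%:E.
    rewrite (variance_Rint lS) ESm ESs; congr EFin; ring.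
  have MS : 'E_P[S]%E = (Num.sqrt 2 * mu)%:E.
    by rewrite (expectationE (L2_L1 lS)) ESm.
  rewrite /D /normal_sqdist MS VS; reflexivity.
clearbody D.
have D_ge0 := d2_sqr_ge0 (cdf X1) (normal_cdf mu (sigma ^+ 2)).
have D_le := normal_sqdist_le sigma_gt0 lX Em Es.
have D_fin : D X1 \is a fin_num.
  rewrite DX (ge0_fin_numE D_ge0); exact: le_lt_trans D_le (ltry _).
set D1 := fine (D X1); have D1E : D X1 = D1%:E by rewrite fineK.
have D1_ge0 : 0 <= D1 by rewrite -lee_fin -D1E DX; exact: D_ge0.
have D1_le : D1 <= 2 * sigma ^+ 2 by rewrite -lee_fin -D1E DX; exact: D_le.
have s2 : 0 < sigma ^+ 2 by exact: exprn_gt0.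
pose e := c / (8 * sigma ^+ 2).
have e0 : 0 < e by rewrite divr_gt0// mulr_gt0.
have es : e * sigma ^+ 2 = c / 8 by rewrite /e; field; rewrite gt_eqF.
rewrite D1E -EFin_expe -!EFinM -EFinD -/e; split; last first.
  rewrite lee_fin.
  (* Since [D1 <= 2 sigma^2], the quadratic term is at most [c D1 / 4]. *)
  have : e * D1 * (2 * sigma ^+ 2 - D1) >= 0.
    by rewrite mulr_ge0 ?subr_ge0// mulr_ge0// ltW.
  nra.
pose q (x : R) := (1 - c / 2) * x + e * x ^+ 2; rewrite -/(q D1).
have near_inf (r : R) : 0 < r -> exists2 x, D1 <= x <= D1 + r & (D S <= (q x)%:E)%E.
  move=> r0; have := D_fin; rewrite DX d2_sqrE => fin.
  have [y] := lb_ereal_inf_adherent r0 fin.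
  case=> [d' [T' [Q [X [Y [cX cY yE]]]]]] ylt.
  have lawX : same_law Q P X X1 by exact/same_law_eq_cdf.
  have lawY : same_law Q (normal_prob mu sigma) Y (fun x => x).
    exact/same_law_normal_cdf.
  have lX' : L2 Q X by exact: (same_law_L2 lawX (@measurable_id _ R setT) lX).
  have lY' : L2 Q Y.
    have lawYg := same_law_trans lawY (normal_prob_affine mu sigma_gt0).
    apply: (same_law_L2 lawYg (@measurable_id _ R setT)).
    by apply: L2D; [exact: L2_cst|apply: L2Z; exact: gauss_id_L2].
  have [_ lXY] := L2B lX' lY'.
  have yR : y = (\int[Q]_t ((X t - Y t) ^+ 2))%:E.
    rewrite yE -(expectationE lXY); congr expectation.
    by apply/funext => t; rewrite real_normK// num_real.
  exists (\int[Q]_t ((X t - Y t) ^+ 2)).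
    apply/andP; split.
      by rewrite -lee_fin -D1E DX; exact: (d2_sqr_le cX cY lX' lY').
    by rewrite -lee_fin EFinD -yR -D1E DX d2_sqrE; exact: ltW.
  rewrite DS; exact: (normalized_sum_d2_le X12_indep X12_id lX Em Es sigma_gt0
    X1_density c_gt0 dg cX cY).
apply/lee_addgt0Pr => r r0.
(* [K] bounds the slope of [q] from [D1] to any [x] in [[D1, D1 + 1]], whatever the sign of
   [1 - c / 2]; couplings within [min 1 (r / K)] of the infimum therefore suffice. *)
pose K := 1 + c + e * (2 * D1 + 1).
have K0 : 0 < K.
  have h : 0 <= 2 * D1 + 1 by rewrite addr_ge0// mulr_ge0.
  by rewrite /K ltr_pwDl ?addr_gt0// mulr_ge0// ltW.
have t0 : 0 < Num.min 1 (r / K) by rewrite lt_min ltr01 divr_gt0.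
have [x /andP[x1 x2] DSx] := near_inf _ t0.
apply: (le_trans DSx); rewrite -EFinD lee_fin -lerBlDl.
have dx1 : x - D1 <= 1 by rewrite lerBlDl (le_trans x2)// lerD2l ge_min lexx.
have dxr : x - D1 <= r / K by rewrite lerBlDl (le_trans x2)// lerD2l ge_min lexx orbT.
apply: (@le_trans _ _ ((x - D1) * K)); last by rewrite -ler_pdivlMr.
have -> : q x - q D1 = (x - D1) * ((1 - c / 2) + e * (x + D1)).
  by rewrite /q; ring.
rewrite ler_wpM2l ?subr_ge0// /K.
have : e * (x + D1) <= e * (2 * D1 + 1) by apply: (ler_wpM2l (ltW e0)); lra.
lra.
Qed.
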